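(* Let $X$ be a smooth projective variety over $\mathbb{C}$ and $B\subset X$ a smooth divisor. Let $d$ be a positive integer, let $M$ be a line bundle on $X$ such that $\mathcal{O}_X(dM)\cong\mathcal{O}_X(B)$, and let $\pi:Y\to X$ be the cyclic covering of degree $d$ defined by $M$ (and branched along $B$). Let $L$ be a line bundle on $X$ and $k$ a non-negative integer. If $L-qM$ is $(k-q)$-jet ample for every $q=0,\ldots,\min(k,d-1)$, then $\pi^*L$ is $k$-jet ample on $Y$.
   Context: All varieties are over the field $\mathbb{C}$. Tensor products and powers of line bundles are written additively, so $L-qM$ means $L\otimes M^{\otimes(-q)}$ and $\mathcal{O}_X(dM)=M^{\otimes d}$. Cyclic covering: let $\overline{M}$ be the total space of $M$, $p:\overline{M}\to X$ the bundle projection, $s_B\in H^0(X,\mathcal{O}_X(B))$ a section with divisor of zeros $B$ (viewed as a section of $M^{\otimes d}$ via the given isomorphism), and $\tau\in H^0(\overline{M},p^*M)$ the tautological section. Then $Y\subset\overline{M}$ is the divisor of zeros of the section $p^*s_B-\tau^d$ of $p^*M^{\otimes d}$, and $\pi=p|_Y:Y\to X$. $k$-jet ampleness: for an integer $k\ge 0$, a line bundle $L$ on a smooth projective variety $X$ is called $k$-jet ample if for every choice of distinct points $y_1,\dots,y_r\in X$ and positive integers $k_1,\dots,k_r$ with $\sum_{i=1}^r k_i=k+1$, the evaluation map $$H^0(X,L)\to H^0\bigl(X,L\otimes\mathcal{O}_X/(\mathfrak{m}_{y_1}^{k_1}\otimes\cdots\otimes\mathfrak{m}_{y_r}^{k_r})\bigr)=\bigoplus_{i=1}^r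 H^0\bigl(X,L\otimes\mathcal{O}_X/\mathfrak{m}_{y_i}^{k_i}\bigr)$$ is surjective, where $\mathfrak{m}_y$ is the ideal sheaf of the point $y$. *)

(* Defs.v *)
From HB Require Import structures.
From mathcomp Require Import all_boot all_order all_algebra.
From mathcomp Require Import all_classical reals topology_structure.
From mathcomp Require Import subtype_topology.
From mathcomp Require Import mpoly.
From mathcomp Require Import complex.

Set Implicit Arguments.
Unset Strict Implicit.
Unset Printing Implicit Defensive.

Import GRing.Theory.

Local Open Scope classical_set_scope.
Local Open Scope ring_scope.

(* Varieties over an algebraically closed field K are treated in the style of
   Serre's FAC: a topological space together with a sheaf of K-valued
   functions.  Since "regular on U" is a pointwise-local condition, the sheaf
   is recorded by the relation "f is regular at x"; O(U) is the set of the f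
   that are regular at every point of U, and the local ring O_{X,x} is the set
   of the f that are regular at x, two such functions being identified when
   they agree near x. *)
Record fun_space (K : closedFieldType) := FunSpace {
  fs_pt :> topologicalType;
  regular_at : fs_pt -> (fs_pt -> K) -> Prop;
  regular_near : forall x f,
    regular_at x f -> \forall y \near x, regular_at y f;
  regular_ext : forall x f g,
    (\forall y \near x, f y = g y) -> regular_at x f -> regular_at x g;
  regular_cst : forall x c, regular_at x (fun=> c);
  regularD : forall x f g,
    regular_at x f -> regular_at x g -> regular_at x (fun y => f y + g y);
  regularM : forall x f g,
    regular_at x f -> regular_at x g -> regular_at x (fun y => f y * g y);
  regular_neq0 : forall x f,
    regular_at x f -> f x != 0 -> \forall y \near x, f y != 0;
  regularV : forall x f,
    regular_at x f -> f x != 0 -> regular_at x (fun y => (f y)^-1) }.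

Arguments regular_at {K X} x f : rename.

Record regular_map (K : closedFieldType) (X Y : fun_space K) := RegularMap {
  rm_fun :> X -> Y;
  rm_continuous : continuous rm_fun;
  rm_regular : forall x f,
    regular_at (rm_fun x) f -> regular_at x (f \o rm_fun) }.

Section RegularMaps.
Variables (K : closedFieldType) (X Y Z : fun_space K).

Program Definition regular_comp (g : regular_map Y Z) (f : regular_map X Y) :
  regular_map X Z := @RegularMap K X Z (g \o f) _ _.
Next Obligation.
by move=> g f x; apply: continuous_comp; exact: rm_continuous.
Qed.
Next Obligation.
by move=> g f x h hreg; exact: (rm_regular (rm_regular hreg)).
Qed.

Definition isomorphic : Prop :=
  exists (f : regular_map X Y) (g : regular_map Y X),
    cancel f g /\ cancel g f.

End RegularMaps.

Lemma near_all (T : topologicalType) (x : T) (P : T -> Prop) :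
  (forall y, P y) -> \forall y \near x, P y.
Proof. exact: nearW. Qed.

Lemma near_open (T : topologicalType) (x : T) (P : T -> Prop) :
  (\forall y \near x, P y) -> exists U, [/\ open U, U x & U `<=` P].
Proof.
by rewrite -nbhs_nearE nbhsE => -[U [oU Ux] UP]; exists U.
Qed.

Lemma open_near (T : topologicalType) (x : T) (U : set T) (P : T -> Prop) :
  open U -> U x -> U `<=` P -> \forall y \near x, P y.
Proof.
by move=> oU Ux UP; apply: filterS UP _; exact: open_nbhs_nbhs.
Qed.

(* The induced structure on a subset: regular functions are the local
   restrictions of regular functions of the ambient space.  For closed Z this
   is the structure of reduced closed subvariety. *)
Section SubSpace.
Variables (K : closedFieldType) (X : fun_space K) (Z : set X).

Definition sub_regular_at (z : Z) (f : Z -> K) : Prop :=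
  exists2 F : X -> K, regular_at (set_val z) F &
    \forall w \near z, f w = F (set_val w).

Lemma set_val_near (z : Z) (P : X -> Prop) :
  (\forall y \near set_val z, P y) -> \forall w \near z, P (set_val w).
Proof. exact: (@initial_topology.initial_continuous Z X set_val z). Qed.

Program Definition sub_fun_space : fun_space K :=
  @FunSpace K (set_type Z) sub_regular_at _ _ _ _ _ _ _.
Next Obligation.
move=> z f [F regF fF].
near=> w; exists F.
  near: w; exact: (set_val_near (regular_near regF)).
by near: w; exact: (near_join fF).
Unshelve. all: by end_near. Qed.
Next Obligation.
move=> z f g fg [F regF fF]; exists F => //.
by apply: filterS2 fg fF => w <-.
Qed.
Next Obligation.
by move=> z c; exists (fun=> c); [exact: regular_cst | exact: near_all].
Qed.
Next Obligation.
move=> z f g [F regF fF] [G regG gG]; exists (fun y => F y + G y).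
  exact: regularD.
by apply: filterS2 fF gG => w -> ->.
Qed.
Next Obligation.
move=> z f g [F regF fF] [G regG gG]; exists (fun y => F y * G y).
  exact: regularM.
by apply: filterS2 fF gG => w -> ->.
Qed.
Next Obligation.
move=> z f [F regF fF]; rewrite (nbhs_singleton fF) => Fz.
have /set_val_near := regular_neq0 regF Fz.
by apply: filterS2 fF => w ->.
Qed.
Next Obligation.
move=> z f [F regF fF]; rewrite (nbhs_singleton fF) => Fz.
exists (fun y => (F y)^-1); first exact: regularV.
by apply: filterS fF => w ->.
Qed.

Program Definition sub_incl : regular_map sub_fun_space X :=
  @RegularMap K sub_fun_space X set_val _ _.
Next Obligation. by move=> z P; exact: set_val_near. Qed.
Next Obligation. by move=> z F regF; exists F => //; exact: near_all. Qed.

End SubSpace.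

Section ProjectiveSpace.
Variables (K : closedFieldType) (n : nat).

Definition proj_pt := {l : {vspace 'rV[K]_n.+1} | \dim l == 1%N}.

HB.instance Definition _ := Choice.on proj_pt.

(* Value of a form at homogeneous coordinates of l.  For p homogeneous, neither
   its vanishing nor a quotient p/q of forms of the same degree depends on the
   choice of the nonzero vector [vpick _] on the line. *)
Definition form_eval (p : {mpoly K[n.+1]}) (l : proj_pt) : K :=
  p.@[fun i => vpick (\val l) ord0 i].

Definition zariski_open (A : set proj_pt) : Prop :=
  forall l, A l -> exists d (p : {mpoly K[n.+1]}),
    [/\ p \is d.-homog, form_eval p l != 0 &
        [set l' | form_eval p l' != 0] `<=` A].

Lemma zariski_openT : zariski_open setT.
Proof.
move=> l _; exists 0%N, 1; split => //; first exact: dhomog1.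
by rewrite /form_eval meval1 oner_neq0.
Qed.

Lemma zariski_openI : setI_closed zariski_open.
Proof.
move=> A B oA oB l [/oA[d [p [hp pl pA]]] /oB[e [q [hq ql qB]]]].
exists (d + e)%N, (p * q); split; first exact: dhomogM.
  by rewrite /form_eval mevalM mulf_neq0.
move=> l' /=; rewrite /form_eval mevalM mulf_eq0 negb_or => /andP[pl' ql'].
by split; [exact: pA | exact: qB].
Qed.

Lemma zariski_open_bigU (I : Type) (f : I -> set proj_pt) :
  (forall i, zariski_open (f i)) -> zariski_open (\bigcup_i f i).
Proof.
move=> of_ l [i _ /of_[d [p [hp pl pf]]]]; exists d, p; split => //.
by move=> l' /pf; exists i.
Qed.

HB.instance Definition _ := isOpenTopological.Build proj_pt
  zariski_openT zariski_openI zariski_open_bigU.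

Lemma form_neq0_near d (p : {mpoly K[n.+1]}) (l : proj_pt) :
  p \is d.-homog -> form_eval p l != 0 ->
  \forall l' \near l, form_eval p l' != 0.
Proof.
move=> hp pl.
have oU : open ([set l' | form_eval p l' != 0] : set proj_pt);
  last by apply: open_near oU pl _.
by move=> l' pl'; exists d, p; split.
Qed.

Definition proj_regular_at (l : proj_pt) (f : proj_pt -> K) : Prop :=
  exists d (p q : {mpoly K[n.+1]}),
    [/\ p \is d.-homog, q \is d.-homog, form_eval q l != 0 &
        \forall l' \near l, f l' = form_eval p l' / form_eval q l'].

Program Definition proj_space : fun_space K :=
  @FunSpace K proj_pt proj_regular_at _ _ _ _ _ _ _.
Next Obligation.
move=> l f [d [p [q [hp hq ql fpq]]]].
near=> l'; exists d, p, q; split => //.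
  by near: l'; exact: form_neq0_near hq ql.
by near: l'; exact: (near_join fpq).
Unshelve. all: by end_near. Qed.
Next Obligation.
move=> l f g fg [d [p [q [hp hq ql fpq]]]]; exists d, p, q; split => //.
by apply: filterS2 fg fpq => l' <-.
Qed.
Next Obligation.
move=> l c; exists 0%N, c%:MP, 1; split.
- by rewrite -[c%:MP]mulr1 mul_mpolyC rpredZ ?dhomog1.
- exact: dhomog1.
- by rewrite /form_eval meval1 oner_neq0.
- by apply: near_all => l'; rewrite /form_eval mevalC meval1 divr1.
Qed.
Next Obligation.
move=> l f g [d [p [q [hp hq ql fpq]]]] [e [r [s [hr hs sl grs]]]].
exists (d + e)%N, (p * s + r * q), (q * s); split.
- by apply: rpredD; [|rewrite addnC]; exact: dhomogM.
- exact: dhomogM.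
- by rewrite /form_eval mevalM mulf_neq0.
near=> l'.
have q0 : form_eval q l' != 0 by near: l'; exact: form_neq0_near hq ql.
have s0 : form_eval s l' != 0 by near: l'; exact: form_neq0_near hs sl.
have -> : f l' = form_eval p l' / form_eval q l' by near: l'.
have -> : g l' = form_eval r l' / form_eval s l' by near: l'.
by rewrite addf_div // /form_eval mevalD !mevalM.
Unshelve. all: by end_near. Qed.
Next Obligation.
move=> l f g [d [p [q [hp hq ql fpq]]]] [e [r [s [hr hs sl grs]]]].
exists (d + e)%N, (p * r), (q * s); split; try exact: dhomogM.
  by rewrite /form_eval mevalM mulf_neq0.
apply: filterS2 fpq grs => l' -> ->.
by rewrite mulf_div /form_eval !mevalM.
Qed.
Next Obligation.
move=> l f [d [p [q [hp hq ql fpq]]]]; rewrite (nbhs_singleton fpq) => pql.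
have pl : form_eval p l != 0.
  by apply: contra_neq pql => ->; rewrite mul0r.
near=> l'.
have -> : f l' = form_eval p l' / form_eval q l' by near: l'.
rewrite mulf_neq0 ?invr_neq0 //; near: l'.
  exact: form_neq0_near hp pl.
exact: form_neq0_near hq ql.
Unshelve. all: by end_near. Qed.
Next Obligation.
move=> l f [d [p [q [hp hq ql fpq]]]]; rewrite (nbhs_singleton fpq) => pql.
exists d, q, p; split => //.
  by apply: contra_neq pql => ->; rewrite mul0r.
by apply: filterS fpq => l' ->; rewrite invf_div.
Qed.

End ProjectiveSpace.

Section Dimension.
Variable T : topologicalType.

Definition irreducible_set (Z : set T) : Prop :=
  Z !=set0 /\ forall A B : set T, closed A -> closed B ->
    Z `<=` A `|` B -> Z `<=` A \/ Z `<=` B.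

Definition irreducible_chain_at (x : T) (n : nat) : Prop :=
  exists Z : nat -> set T,
    (forall i, (i <= n)%N -> [/\ closed (Z i), irreducible_set (Z i) & Z i x])
    /\ (forall i, (i < n)%N -> Z i `<` Z i.+1).

(* For a variety, irreducible closed sets through x correspond to the primes of
   the local ring at x, so this is the Krull dimension of that ring. *)
Definition dim_at (x : T) (n : nat) : Prop :=
  irreducible_chain_at x n /\ ~ irreducible_chain_at x n.+1.

(* Irreducible closed subsets of codimension 1 of an irreducible space. *)
Definition prime_divisor (Z : set T) : Prop :=
  [/\ closed Z, irreducible_set Z, Z `<` setT &
      forall W : set T, closed W -> irreducible_set W -> ~ (Z `<` W /\ W `<` setT)].

End Dimension.

Section LocalRing.
Variables (K : closedFieldType) (X : fun_space K) (x : X).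

Definition max_ideal (f : X -> K) : Prop := regular_at x f /\ f x = 0.

Definition max_ideal_pow (k : nat) (f : X -> K) : Prop :=
  exists N (a : 'I_N -> X -> K) (t : 'I_N -> 'I_k -> X -> K),
    [/\ forall i, regular_at x (a i), forall i j, max_ideal (t i j) &
        \forall y \near x, f y = \sum_i a i y * \prod_j t i j y].

(* dim_K (m_x / m_x^2) = n, witnessed by a basis. *)
Definition cotangent_dim (n : nat) : Prop :=
  exists2 t : 'I_n -> X -> K, forall i, max_ideal (t i) &
    forall f, max_ideal f ->
      exists! c : 'rV[K]_n,
        max_ideal_pow 2 (fun y => f y - \sum_i c ord0 i * t i y).

Definition smooth_at : Prop := exists2 n, dim_at x n & cotangent_dim n.

End LocalRing.

Section SmoothVarieties.
Variables (K : closedFieldType) (X : fun_space K).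

Definition smooth : Prop := forall x : X, smooth_at x.

Definition projective_variety : Prop :=
  exists n (Z : set (proj_space K n)),
    [/\ closed Z, irreducible_set Z & isomorphic X (sub_fun_space Z)].

Definition smooth_projective_variety : Prop := projective_variety /\ smooth.

End SmoothVarieties.

(* A smooth divisor is reduced, hence determined by its support, a finite
   (possibly empty) union of prime divisors; it need not be connected. *)
Definition smooth_divisor (K : closedFieldType) (X : fun_space K) (B : set X) :
  Prop :=
  (exists s : seq (set X),
     (forall Z, Z \in s -> prime_divisor Z) /\
     B = [set x | exists2 Z, Z \in s & Z x])
  /\ smooth (sub_fun_space B).

(* Line bundles are given by an open cover and a cocycle of transition
   functions: a section is a family (s_i) with s_i = g_ij s_j. *)
Record line_bundle (K : closedFieldType) (X : fun_space K) := LineBundle {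
  lb_idx : Type;
  lb_dom : lb_idx -> set X;
  lb_tr : lb_idx -> lb_idx -> X -> K;
  lb_open : forall i, open (lb_dom i);
  lb_cover : forall x, exists i, lb_dom i x;
  lb_tr_regular : forall i j x, lb_dom i x -> lb_dom j x ->
    regular_at x (lb_tr i j);
  lb_tr_id : forall i x, lb_dom i x -> lb_tr i i x = 1;
  lb_tr_cocycle : forall i j l x, lb_dom i x -> lb_dom j x -> lb_dom l x ->
    lb_tr i j x * lb_tr j l x = lb_tr i l x }.

Arguments lb_dom {K X} L i : rename.
Arguments lb_tr {K X} L i j : rename.
Arguments lb_open {K X} L i : rename.
Arguments lb_cover {K X} L x : rename.

Section LineBundles.
Variables (K : closedFieldType) (X : fun_space K).
Implicit Types L M : line_bundle X.

Lemma lb_tr_neq0 L i j x : lb_dom L i x -> lb_dom L j x -> lb_tr L i j x != 0.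
Proof.
move=> Ui Uj; apply/eqP => g0; have := lb_tr_cocycle Ui Uj Ui.
by rewrite g0 mul0r lb_tr_id // => /eqP; rewrite eq_sym oner_eq0.
Qed.

Lemma regularX x (f : X -> K) m :
  regular_at x f -> regular_at x (fun y => f y ^+ m).
Proof.
move=> rf; elim: m => [|m IH]; first exact: regular_cst.
apply: regular_ext (regularM rf IH).
by apply: near_all => y; rewrite exprS.
Qed.

Lemma regularXz x (f : X -> K) (m : int) :
  regular_at x f -> f x != 0 -> regular_at x (fun y => f y ^ m).
Proof.
move=> rf f0; case: m => m; first exact: regularX.
by apply: regularV; [exact: regularX | rewrite expf_neq0].
Qed.

Program Definition lb_tensor L M : line_bundle X := @LineBundle K X
  (lb_idx L * lb_idx M)%type
  (fun u => lb_dom L u.1 `&` lb_dom M u.2)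
  (fun u v x => lb_tr L u.1 v.1 x * lb_tr M u.2 v.2 x) _ _ _ _ _.
Next Obligation. by move=> L M u; apply: openI; exact: lb_open. Qed.
Next Obligation.
move=> L M x; have [i Ui] := lb_cover L x; have [a Ua] := lb_cover M x.
by exists (i, a).
Qed.
Next Obligation.
by move=> L M u v x [? ?] [? ?]; apply: regularM; exact: lb_tr_regular.
Qed.
Next Obligation. by move=> L M u x [? ?] /=; rewrite !lb_tr_id // mulr1. Qed.
Next Obligation.
move=> L M u v w x [? ?] [? ?] [? ?].
by rewrite /= mulrACA !lb_tr_cocycle.
Qed.

Program Definition lb_pow M (m : int) : line_bundle X := @LineBundle K X
  (lb_idx M) (lb_dom M) (fun i j x => lb_tr M i j x ^ m) _ _ _ _ _.
Next Obligation. by move=> M m i; exact: lb_open. Qed.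
Next Obligation. by move=> M m x; exact: lb_cover. Qed.
Next Obligation.
move=> M m i j x Ui Uj.
by apply: regularXz; [exact: lb_tr_regular | exact: lb_tr_neq0].
Qed.
Next Obligation. by move=> M m i x Ui /=; rewrite lb_tr_id // exp1rz. Qed.
Next Obligation.
move=> M m i j l x Ui Uj Ul.
by rewrite /= -expfzMl lb_tr_cocycle.
Qed.

Definition lb_family L := lb_idx L -> X -> K.

Definition section_at L (x : X) (s : lb_family L) : Prop :=
  (forall i, lb_dom L i x -> regular_at x (s i)) /\
  (forall i j, lb_dom L i x -> lb_dom L j x -> s i x = lb_tr L i j x * s j x).

Definition global_section L (s : lb_family L) : Prop :=
  forall x, section_at x s.

Definition section_germ L (x : X) (s : lb_family L) : Prop :=
  \forall y \near x, section_at y s.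

(* s and t have the same image in L (x) O_X / m_x^k *)
Definition eq_jet L (x : X) (k : nat) (s t : lb_family L) : Prop :=
  forall i, lb_dom L i x -> max_ideal_pow x k (fun y => s i y - t i y).

Definition jet_ample L (k : nat) : Prop :=
  forall (r : nat) (y : 'I_r -> X) (m : 'I_r -> nat),
    injective y -> (forall i, 0 < m i)%N -> (\sum_i m i = k.+1)%N ->
    forall t : 'I_r -> lb_family L, (forall i, section_germ (y i) (t i)) ->
      exists2 s : lb_family L, global_section s &
        forall i, eq_jet (y i) (m i) s (t i).

Definition zero_locus L (s : lb_family L) : set X :=
  [set x | forall i, lb_dom L i x -> s i x = 0].

(* The divisor of zeros of s is the reduced divisor B: near every point, s
   generates the ideal of the functions vanishing on B.  Then s is a canonical
   section of O_X(B). *)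
Definition zero_divisor_is L (s : lb_family L) (B : set X) : Prop :=
  forall x i, lb_dom L i x -> forall f, regular_at x f ->
    ((\forall y \near x, B y -> f y = 0) <->
     (exists2 h, regular_at x h & \forall y \near x, f y = h y * s i y)).

(* In local trivialisations, an isomorphism L -> M is multiplication by
   invertible functions: it sends (s_i) to (phi_ai s_i). *)
Record lb_iso L M := LbIso {
  iso_fun : lb_idx M -> lb_idx L -> X -> K;
  iso_regular : forall a i x, lb_dom M a x -> lb_dom L i x ->
    regular_at x (iso_fun a i);
  iso_neq0 : forall a i x, lb_dom M a x -> lb_dom L i x ->
    iso_fun a i x != 0;
  iso_compat : forall a b i j x,
    lb_dom M a x -> lb_dom M b x -> lb_dom L i x -> lb_dom L j x ->
    iso_fun a i x = lb_tr M a b x * iso_fun b j x * lb_tr L j i x }.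

Definition lb_chart L (x : X) : lb_idx L := projT1 (cid (lb_cover L x)).

(* On sections the choice of the chart of L at x is immaterial. *)
Definition iso_section L M (phi : lb_iso L M) (s : lb_family L) :
  lb_family M :=
  fun a x => iso_fun phi a (lb_chart L x) x * s (lb_chart L x) x.

End LineBundles.

Section Pullback.
Variables (K : closedFieldType) (X Y : fun_space K) (f : regular_map Y X).

Program Definition lb_pullback (L : line_bundle X) : line_bundle Y :=
  @LineBundle K Y (lb_idx L) (fun i => f @^-1` lb_dom L i)
    (fun i j => lb_tr L i j \o f) _ _ _ _ _.
Next Obligation.
move=> L i; have /continuousP := @rm_continuous _ _ _ f; apply.
exact: lb_open.
Qed.
Next Obligation. by move=> L y; exact: lb_cover. Qed.
Next Obligation.
by move=> L i j y Ui Uj; apply: rm_regular; exact: lb_tr_regular.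
Qed.
Next Obligation. by move=> L i y Ui; exact: lb_tr_id. Qed.
Next Obligation. by move=> L i j l y Ui Uj Ul; exact: lb_tr_cocycle. Qed.

Definition pull_section (L : line_bundle X) (s : lb_family L) :
  lb_family (lb_pullback L) := fun i => s i \o f.

End Pullback.

Arguments pull_section {K X Y} f {L} s.

Section TotalSpace.
Variables (K : closedFieldType) (X : fun_space K) (M : line_bundle X).

(* A point over x is a vector of the fibre of M at x, given by its coordinates
   in all the trivialisations around x (and 0 in the other ones). *)
Record total_pt := TotalPt {
  tot_base : X;
  tot_coord : lb_idx M -> K;
  tot_coord_tr : forall i j, lb_dom M i tot_base -> lb_dom M j tot_base ->
    tot_coord i = lb_tr M i j tot_base * tot_coord j;
  tot_coord_out : forall i, ~ lb_dom M i tot_base -> tot_coord i = 0 }.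

HB.instance Definition _ := gen_eqMixin total_pt.
HB.instance Definition _ := gen_choiceMixin total_pt.

(* The functions that are polynomial on the fibres near x, with coefficients in
   the local ring of X at x. *)
Inductive fibre_poly (x : X) : (total_pt -> K) -> Prop :=
| fibre_poly_base a : regular_at x a -> fibre_poly x (fun t => a (tot_base t))
| fibre_poly_coord i : lb_dom M i x -> fibre_poly x (fun t => tot_coord t i)
| fibre_polyD P Q : fibre_poly x P -> fibre_poly x Q ->
    fibre_poly x (fun t => P t + Q t)
| fibre_polyM P Q : fibre_poly x P -> fibre_poly x Q ->
    fibre_poly x (fun t => P t * Q t).

Lemma fibre_poly_near x P :
  fibre_poly x P -> \forall y \near x, fibre_poly y P.
Proof.
elim=> {P} [a ra|i Ui|P Q _ IP _ IQ|P Q _ IP _ IQ].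
- by apply: filterS (regular_near ra) => y; exact: fibre_poly_base.
- by apply: open_near (lb_open M i) Ui _ => y; exact: fibre_poly_coord.
- by apply: filterS2 IP IQ => y; exact: fibre_polyD.
- by apply: filterS2 IP IQ => y; exact: fibre_polyM.
Qed.

Definition total_open (A : set total_pt) : Prop :=
  forall t, A t -> exists Q, [/\ fibre_poly (tot_base t) Q, Q t != 0 &
    \forall y \near tot_base t, forall u, tot_base u = y -> Q u != 0 -> A u].

Lemma total_openT : total_open setT.
Proof.
move=> t _; exists (fun=> 1); split; last by apply: near_all.
  by apply: (@fibre_poly_base _ (fun=> 1)); exact: regular_cst.
exact: oner_neq0.
Qed.

Lemma total_openI : setI_closed total_open.
Proof.
move=> A B oA oB t [/oA[P [pP Pt PA]] /oB[Q [pQ Qt QB]]].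
exists (fun u => P u * Q u); split; [exact: fibre_polyM|exact: mulf_neq0|].
apply: filterS2 PA QB => y PA QB u uy; rewrite mulf_eq0 negb_or => /andP[Pu Qu].
by split; [exact: PA | exact: QB].
Qed.

Lemma total_open_bigU (I : Type) (f : I -> set total_pt) :
  (forall i, total_open (f i)) -> total_open (\bigcup_i f i).
Proof.
move=> of_ t [i _ /of_[P [pP Pt Pf]]]; exists P; split => //.
by apply: filterS Pf => y Pf u uy Pu; exists i => //; exact: Pf.
Qed.

HB.instance Definition _ := isOpenTopological.Build total_pt
  total_openT total_openI total_open_bigU.

Lemma tot_base_near (t : total_pt) (P : X -> Prop) :
  (\forall y \near tot_base t, P y) -> \forall u \near t, P (tot_base u).
Proof.
move=> /near_open[U [oU Ut UP]].
have oU' : open ([set u | U (tot_base u)] : set total_pt); last first.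
  by apply: open_near oU' Ut _ => u; exact: UP.
move=> u Uu; exists (fun=> 1); split; last by apply: open_near oU Uu _ => y Uy v /= ->.
  by apply: (@fibre_poly_base _ (fun=> 1)); exact: regular_cst.
exact: oner_neq0.
Qed.

Lemma fibre_poly_neq0_near (t : total_pt) P :
  fibre_poly (tot_base t) P -> P t != 0 -> \forall u \near t, P u != 0.
Proof.
move=> /fibre_poly_near/near_open[U [oU Ut UP]] Pt.
have oU' : open ([set u | U (tot_base u) /\ P u != 0] : set total_pt);
  last by apply: open_near oU' (conj Ut Pt) _ => u [].
move=> u [Uu Pu]; exists P; split => //; first exact: UP.
by apply: open_near oU Uu _ => y Uy v vy Pv; split=> //; rewrite vy.
Qed.

Definition total_regular_at (t : total_pt) (f : total_pt -> K) : Prop :=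
  exists P Q, [/\ fibre_poly (tot_base t) P, fibre_poly (tot_base t) Q,
    Q t != 0 & \forall u \near t, f u = P u / Q u].

Program Definition total_space : fun_space K :=
  @FunSpace K total_pt total_regular_at _ _ _ _ _ _ _.
Next Obligation.
move=> t f [P [Q [pP pQ Qt fPQ]]].
near=> u; exists P, Q; split.
- near: u; exact: (tot_base_near (fibre_poly_near pP)).
- near: u; exact: (tot_base_near (fibre_poly_near pQ)).
- by near: u; exact: fibre_poly_neq0_near.
- by near: u; exact: (near_join fPQ).
Unshelve. all: by end_near. Qed.
Next Obligation.
move=> t f g fg [P [Q [pP pQ Qt fPQ]]]; exists P, Q; split => //.
by apply: filterS2 fg fPQ => u <-.
Qed.
Next Obligation.
move=> t c; exists (fun=> c), (fun=> 1); split.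
- by apply: (@fibre_poly_base _ (fun=> c)); exact: regular_cst.
- by apply: (@fibre_poly_base _ (fun=> 1)); exact: regular_cst.
- exact: oner_neq0.
- by apply: near_all => u; rewrite divr1.
Qed.
Next Obligation.
move=> t f g [P [Q [pP pQ Qt fPQ]]] [R [S [pR pS St gRS]]].
exists (fun u => P u * S u + R u * Q u), (fun u => Q u * S u); split.
- by apply: fibre_polyD; exact: fibre_polyM.
- exact: fibre_polyM.
- by rewrite mulf_neq0.
near=> u.
have Q0 : Q u != 0 by near: u; exact: fibre_poly_neq0_near.
have S0 : S u != 0 by near: u; exact: fibre_poly_neq0_near.
have -> : f u = P u / Q u by near: u.
have -> : g u = R u / S u by near: u.
by rewrite addf_div.
Unshelve. all: by end_near. Qed.
Next Obligation.
move=> t f g [P [Q [pP pQ Qt fPQ]]] [R [S [pR pS St gRS]]].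
exists (fun u => P u * R u), (fun u => Q u * S u); split.
- exact: fibre_polyM.
- exact: fibre_polyM.
- by rewrite mulf_neq0.
by apply: filterS2 fPQ gRS => u -> ->; rewrite mulf_div.
Qed.
Next Obligation.
move=> t f [P [Q [pP pQ Qt fPQ]]]; rewrite (nbhs_singleton fPQ) => PQt.
have Pt : P t != 0 by apply: contra_neq PQt => ->; rewrite mul0r.
near=> u.
have -> : f u = P u / Q u by near: u.
by rewrite mulf_neq0 ?invr_neq0 //; near: u; exact: fibre_poly_neq0_near.
Unshelve. all: by end_near. Qed.
Next Obligation.
move=> t f [P [Q [pP pQ Qt fPQ]]]; rewrite (nbhs_singleton fPQ) => PQt.
exists Q, P; split => //.
  by apply: contra_neq PQt => ->; rewrite mul0r.
by apply: filterS fPQ => u ->; rewrite invf_div.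
Qed.

Program Definition bundle_proj : regular_map total_space X :=
  @RegularMap K total_space X tot_base _ _.
Next Obligation. by move=> t P; exact: tot_base_near. Qed.
Next Obligation.
move=> t f rf; exists (f \o tot_base), (fun=> 1); split.
- exact: fibre_poly_base.
- by apply: (@fibre_poly_base _ (fun=> 1)); exact: regular_cst.
- exact: oner_neq0.
- by apply: near_all => u; rewrite divr1.
Qed.

Definition tautological : lb_family (lb_pullback bundle_proj M) :=
  fun i (t : total_space) => tot_coord t i.

End TotalSpace.

Arguments tautological {K X} M i t.

Section CyclicCovering.
Variables (K : closedFieldType) (X : fun_space K) (M : line_bundle X) (d : nat).
Variable sB : lb_family (lb_pow M d%:Z).

(* The section p^* s_B - tau^d of p^* M^d. *)
Definition cyclic_equation :
  lb_family (lb_pullback (bundle_proj M) (lb_pow M d%:Z)) :=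
  fun i t => pull_section (bundle_proj M) sB i t - tautological M i t ^+ d.

(* When the divisor of zeros of s_B is smooth, the zero scheme of the equation
   is smooth, hence reduced, so it is the closed subvariety below. *)
Definition cyclic_cover : fun_space K :=
  sub_fun_space (zero_locus cyclic_equation).

Definition cyclic_proj : regular_map cyclic_cover X :=
  regular_comp (bundle_proj M) (sub_incl (zero_locus cyclic_equation)).

End CyclicCovering.

(* Main.v *)
(* A section of pi^*L is sought as sum_(q < d) tau^q s_q with s_q a section of
   L - qM, chosen for q = d - 1, ..., 0 in turn.  Let w(x) be the sum of the
   multiplicities prescribed at the points of Y over x.  At each x it suffices
   that s_q have a suitable jet modulo m_x^(w(x) - q), which may depend on
   s_(q+1), ..., s_(d-1):
   - if s_B(x) = 0, then tau vanishes at the only point y over x, every germ at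
     y is congruent to some sum_(q < d) tau^q f_q modulo a given power of m_y,
     and tau^q m_x^(m-q) is contained in m_y^m;
   - otherwise tau is congruent at each point over x to a d-th root of s_B
     modulo m_x^N (Hensel's lemma), and the conditions are solved by Newton
     interpolation at these roots, one repeated division by tau - c for each
     root c.
   As sum_x (w(x) - q) <= k + 1 - q (truncated subtractions), the jets needed at
   step q are provided by the (k-q)-jet ampleness of L - qM. *)

Require Import Defs.
From mathcomp Require Import all_boot all_order all_algebra.
From mathcomp Require Import all_classical reals topology_structure complex.
From mathcomp Require Import ring.

Set Implicit Arguments.
Unset Strict Implicit.
Unset Printing Implicit Defensive.

Import GRing.Theory.
Local Open Scope classical_set_scope.
Local Open Scope ring_scope.

(** * Powers of the maximal ideal of the local ring at a point *)

Section LocalRingTheory.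
Variables (K : closedFieldType) (X : fun_space K) (x : X).
Implicit Types f g : X -> K.

Lemma eq_regular f g : f =1 g -> regular_at x f -> regular_at x g.
Proof. by move=> fg; apply: regular_ext; exact: near_all. Qed.

Lemma regularN f : regular_at x f -> regular_at x (fun z => - f z).
Proof.
by move/(regularM (regular_cst x (-1))); apply: eq_regular => z; rewrite mulN1r.
Qed.

Lemma regularB f g :
  regular_at x f -> regular_at x g -> regular_at x (fun z => f z - g z).
Proof. by move=> rf /regularN; exact: regularD. Qed.

Lemma regular_sum (I : Type) (r : seq I) (F : I -> X -> K) :
  (forall i, regular_at x (F i)) -> regular_at x (fun z => \sum_(i <- r) F i z).
Proof.
move=> rF; elim: r => [|i r IH].
  by apply: eq_regular (regular_cst x 0) => z; rewrite big_nil.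
by apply: eq_regular (regularD (rF i) IH) => z; rewrite big_cons.
Qed.

Lemma regular_prod (I : Type) (r : seq I) (F : I -> X -> K) :
  (forall i, regular_at x (F i)) -> regular_at x (fun z => \prod_(i <- r) F i z).
Proof.
move=> rF; elim: r => [|i r IH].
  by apply: eq_regular (regular_cst x 1) => z; rewrite big_nil.
by apply: eq_regular (regularM (rF i) IH) => z; rewrite big_cons.
Qed.

Lemma max_ideal_pow_ext k f g : (\forall z \near x, f z = g z) ->
  max_ideal_pow x k f -> max_ideal_pow x k g.
Proof.
move=> fg [N [a [t [ra mt ft]]]]; exists N, a, t; split=> //.
by apply: filterS2 fg ft => z <-.
Qed.

Lemma eq_max_ideal_pow k f g : f =1 g ->
  max_ideal_pow x k f -> max_ideal_pow x k g.
Proof. by move=> fg; apply: max_ideal_pow_ext; exact: near_all. Qed.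

(** Allows any finite index types instead of ordinals, so that sums and products of elements of
    ideal powers can be indexed by sum and product types. *)
Lemma max_ideal_pow_sum (I J : finType) (a : I -> X -> K)
    (t : I -> J -> X -> K) f :
  (forall i, regular_at x (a i)) -> (forall i j, max_ideal x (t i j)) ->
  (\forall z \near x, f z = \sum_i a i z * \prod_j t i j z) ->
  max_ideal_pow x #|J| f.
Proof.
move=> ra mt ft; exists #|I|, (fun i => a (enum_val i)).
exists (fun i j => t (enum_val i) (enum_val j)); split=> //.
apply: filterS ft => z ->.
rewrite (reindex (@enum_val I I)) /=; last first.
  by apply: onW_bij; exact: enum_val_bij.
apply: eq_bigr => i _; congr (_ * _).
rewrite (reindex (@enum_val J J)) //=.
by apply: onW_bij; exact: enum_val_bij.
Qed.

Lemma max_ideal_pow_regular k f : max_ideal_pow x k f -> regular_at x f.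
Proof.
move=> [N [a [t [ra mt ft]]]]; apply: regular_ext (_ : regular_at x _).
  by apply: filterS ft => z ->.
apply: regular_sum => i; apply: regularM => //; apply: regular_prod => j.
by case: (mt i j).
Qed.

Lemma max_ideal_powD k f g : max_ideal_pow x k f -> max_ideal_pow x k g ->
  max_ideal_pow x k (fun z => f z + g z).
Proof.
move=> [N [a [t [ra mt ft]]]] [N' [b [u [rb mu gu]]]].
rewrite -[k]card_ord.
apply: (@max_ideal_pow_sum ('I_N + 'I_N')%type 'I_k
  (fun i => match i with inl i => a i | inr i => b i end)
  (fun i => match i with inl i => t i | inr i => u i end)).
- by case.
- by case.
by apply: filterS2 ft gu => z -> ->; rewrite big_sumType.
Qed.

Lemma max_ideal_powM k l f g : max_ideal_pow x k f -> max_ideal_pow x l g ->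
  max_ideal_pow x (k + l) (fun z => f z * g z).
Proof.
move=> [N [a [t [ra mt ft]]]] [N' [b [u [rb mu gu]]]].
have -> : (k + l)%N = #|{: 'I_k + 'I_l}| by rewrite card_sum !card_ord.
apply: (@max_ideal_pow_sum ('I_N * 'I_N')%type ('I_k + 'I_l)%type
  (fun i z => a i.1 z * b i.2 z)
  (fun i j => match j with inl j => t i.1 j | inr j => u i.2 j end)).
- by move=> i; exact: regularM.
- by move=> i [].
apply: filterS2 ft gu => z -> ->; rewrite big_distrlr pair_big /=.
by apply: eq_bigr => i _; rewrite big_sumType mulrACA.
Qed.

Lemma max_ideal_pow0 f : regular_at x f -> max_ideal_pow x 0 f.
Proof.
move=> rf; exists 1%N, (fun=> f), (fun _ _ _ => 0); split=> //.
- by move=> _ [].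
- by apply: near_all => z; rewrite big_ord1 big_ord0 mulr1.
Qed.

Lemma max_ideal_pow1 f : max_ideal x f -> max_ideal_pow x 1 f.
Proof.
move=> mf; exists 1%N, (fun _ _ => 1), (fun _ _ => f); split=> //.
- by move=> _; exact: regular_cst.
- by apply: near_all => z; rewrite !big_ord1 mul1r.
Qed.

Lemma max_ideal_pow_cst0 k : max_ideal_pow x k (fun=> 0).
Proof.
exists 0%N, (fun _ _ => 0), (fun _ _ _ => 0); split=> [[]//|[]//|].
by apply: near_all => z; rewrite big_ord0.
Qed.

Lemma max_ideal_powMl k f g : regular_at x g -> max_ideal_pow x k f ->
  max_ideal_pow x k (fun z => g z * f z).
Proof. by move=> /max_ideal_pow0; exact: max_ideal_powM. Qed.

Lemma max_ideal_powMr k f g : regular_at x g -> max_ideal_pow x k f ->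
  max_ideal_pow x k (fun z => f z * g z).
Proof.
by move=> rg /(max_ideal_powMl rg); apply: eq_max_ideal_pow => z; rewrite mulrC.
Qed.

Lemma max_ideal_powB k f g : max_ideal_pow x k f -> max_ideal_pow x k g ->
  max_ideal_pow x k (fun z => f z - g z).
Proof.
move=> mf /(max_ideal_powMl (regular_cst x (-1))) /(max_ideal_powD mf).
by apply: eq_max_ideal_pow => z; rewrite mulN1r.
Qed.

Lemma max_ideal_powX k f : max_ideal x f ->
  max_ideal_pow x k (fun z => f z ^+ k).
Proof.
move=> mf; elim: k => [|k IH].
  by apply: max_ideal_pow0; exact: regular_cst.
rewrite -addn1 addnC; have := max_ideal_powM (max_ideal_pow1 mf) IH.
by apply: eq_max_ideal_pow => z; rewrite exprS.
Qed.

Lemma max_ideal_pow_le k l f : (k <= l)%N -> max_ideal_pow x l f ->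
  max_ideal_pow x k f.
Proof.
move=> /subnKC <- [N [a [t [ra mt ft]]]].
(* The surplus [l - k] factors of each product are absorbed into its coefficient. *)
exists N, (fun i z => a i z * \prod_j t i (rshift k j) z).
exists (fun i j => t i (lshift _ j)); split => //.
  move=> i; apply: regularM => //; apply: regular_prod => j.
  by case: (mt i (rshift k j)).
apply: filterS ft => z ->; apply: eq_bigr => i _.
by rewrite big_split_ord mulrA mulrAC.
Qed.

Lemma max_ideal_pow_eval0 k f : (0 < k)%N -> max_ideal_pow x k f -> f x = 0.
Proof.
move=> k0 /(max_ideal_pow_le k0)[N [a [t [_ mt ft]]]].
rewrite (nbhs_singleton ft) big1 // => i _.
by rewrite big_ord1; case: (mt i ord0) => _ ->; rewrite mulr0.
Qed.

End LocalRingTheory.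

Lemma max_ideal_pow_comp (K : closedFieldType) (X Y : fun_space K)
    (p : regular_map Y X) (y : Y) k f :
  max_ideal_pow (p y) k f -> max_ideal_pow y k (f \o p).
Proof.
move=> [N [a [t [ra mt ft]]]].
exists N, (fun i => a i \o p), (fun i j => t i j \o p); split.
- by move=> i; exact: rm_regular.
- by move=> i j; case: (mt i j) => rt t0; split; [exact: rm_regular|].
exact: (@rm_continuous _ _ _ p y _ ft).
Qed.

(** * Polynomials with germs as coefficients, and the game of choosing the coefficients *)

Section CoefficientLists.
Variables (K : closedFieldType) (X : fun_space K).
Implicit Types (x z : X) (h : X -> K) (l : seq (X -> K)).

(** Coefficients come lowest degree first. The point z and the value c of the variable are
    independent, because the coefficients live on X while tau lives on Y. *)
Definition horner_fun l z (c : K) : K := foldr (fun h v => h z + c * v) 0 l.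

Definition regular_coefs x l : Prop :=
  foldr (fun h P => regular_at x h /\ P) True l.

(** Here [p] is a bare function that pulls germs back, so that both the identity of X and a
    projection onto X are instances. *)
Lemma horner_fun_regular (Y : fun_space K) (y : Y) (p : Y -> X) (c : Y -> K) l :
  (forall f, regular_at (p y) f -> regular_at y (f \o p)) -> regular_at y c ->
  regular_coefs (p y) l -> regular_at y (fun w => horner_fun l (p w) (c w)).
Proof.
move=> pr rc; elim: l => [_|h l IH /= [rh /IH rl]]; first exact: regular_cst.
exact: regularD (pr _ rh) (regularM rc rl).
Qed.

Lemma regular_horner_fun x (c : X -> K) l : regular_at x c ->
  regular_coefs x l -> regular_at x (fun z => horner_fun l z (c z)).
Proof. exact: (@horner_fun_regular X x id). Qed.

(* The quotient by T - c of [h :: l], not of [l]; it does not depend on the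
   constant term h. *)
Fixpoint synth_div (c : X -> K) l : seq (X -> K) :=
  if l is h :: l' then (fun z => horner_fun l z (c z)) :: synth_div c l'
  else [::].

Lemma synth_divE (c : X -> K) h l z (u : K) :
  horner_fun (h :: l) z u =
  horner_fun (h :: l) z (c z) + (u - c z) * horner_fun (synth_div c l) z u.
Proof.
elim: l h => [|h' l IH] h /=; first by ring.
by move: (IH h') => /= ->; ring.
Qed.

Lemma regular_synth_div x (c : X -> K) l : regular_at x c ->
  regular_coefs x l -> regular_coefs x (synth_div c l).
Proof.
move=> rc; elim: l => //= h l IH [rh rl]; split; last exact: IH.
exact: (@regular_horner_fun x c (h :: l)).
Qed.

(* Coefficients are chosen from the top degree down to degree 0: at degree n
   the strategy names a germ f, and the adversary returns any h congruent to f
   modulo m_x^(M - n).  [wins] says that G can be enforced on the final list. *)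
Fixpoint wins x (M : nat) (G : seq (X -> K) -> Prop) (n : nat) l : Prop :=
  if n is n'.+1 then
    exists2 f, regular_at x f & forall h, regular_at x h ->
      max_ideal_pow x (M - n') (fun z => h z - f z) -> wins x M G n' (h :: l)
  else G l.

Lemma wins_sub x M (G G' : seq (X -> K) -> Prop) n l :
  (forall l', regular_coefs x l' -> G l' -> G' l') ->
  regular_coefs x l -> wins x M G n l -> wins x M G' n l.
Proof.
move=> GG'; elim: n l => [|n IH] l rl /=; first exact: GG'.
by move=> [f rf W]; exists f => // h rh /(W _ rh); apply: IH.
Qed.

Lemma wins_trivial x M (G : seq (X -> K) -> Prop) n l :
  (forall l', G l') -> wins x M G n l.
Proof.
move=> GT; elim: n l => [|n IH] l //=.
by exists (fun=> 0) => //; exact: regular_cst.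
Qed.

(** The game for the dividend is the game for the quotient by T - c followed by one last move. A
    coefficient h chosen on top of l contributes h + c l(c) to the quotient, so a target f' there
    becomes the target f' - c l(c) here. The last move fixes the remainder, that is, the value at c.
    As degrees drop by one in the quotient, [M' < M] makes the precision sufficient. *)
Lemma wins_synth_div x M M' (c f : X -> K) (G G' : seq (X -> K) -> Prop) n l :
  regular_at x c -> regular_at x f -> (M' < M)%N ->
  (forall h l', regular_at x h -> regular_coefs x l' ->
     max_ideal_pow x M (fun z => horner_fun (h :: l') z (c z) - f z) ->
     G' (synth_div c l') -> G (h :: l')) ->
  regular_coefs x l ->
  wins x M' G' n (synth_div c l) -> wins x M G n.+1 l.
Proof.
move=> rc rf MM' GG'; elim: n l => [|n IH] l rl.
  move=> /= Gl; exists (fun z => f z - c z * horner_fun l z (c z)).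
    by apply: regularB => //; apply: regularM => //; exact: regular_horner_fun.
  move=> h rh; rewrite subn0 => hM; apply: GG' => //.
  by apply: eq_max_ideal_pow hM => z /=; ring.
move=> [f' rf' W].
exists (fun z => f' z - c z * horner_fun l z (c z)).
  by apply: regularB => //; apply: regularM => //; exact: regular_horner_fun.
move=> h rh hM; apply: IH => //; apply: W.
  exact: (@regular_horner_fun x c (h :: l)).
have : max_ideal_pow x (M - n.+1) (fun z => horner_fun (h :: l) z (c z) - f' z).
  by apply: eq_max_ideal_pow hM => z /=; ring.
by apply: max_ideal_pow_le; rewrite -(subSS n M') leq_sub2r.
Qed.

(** Newton interpolation by induction on the nodes: once the value at the first node is prescribed,
    the quotient by T - c must take the divided differences at the other nodes. Since each
    multiplicity is positive, dropping a node lowers the total, as [wins_synth_div] requires. *)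
Lemma wins_interpolation x (J : eqType) (js : seq J) (c f : J -> X -> K)
    (m : J -> nat) M n l :
  uniq js -> {in js &, forall i j, c i x = c j x -> i = j} ->
  (forall j, regular_at x (c j)) -> (forall j, regular_at x (f j)) ->
  (forall j, 0 < m j)%N -> (size js <= n)%N -> (\sum_(j <- js) m j <= M)%N ->
  regular_coefs x l ->
  wins x M (fun l' => forall j, j \in js ->
    max_ideal_pow x (m j) (fun z => horner_fun l' z (c j z) - f j z)) n l.
Proof.
move=> + + rc + m0; elim: js f M n l => [|j0 js IH] f M n l.
  by move=> *; exact: wins_trivial.
rewrite /= big_cons => /andP[j0js ujs] inj rf; case: n => // n sz SM rl.
have cj0 j : j \in js -> c j x - c j0 x != 0.
  move=> jj; rewrite subr_eq0; apply: contraNneq j0js => cc.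
  have <- // : j = j0 by apply: inj => //; rewrite inE ?eqxx ?jj ?orbT.
(* Divided differences are regular because the nodes have distinct values at x. Outside [js] the
   denominator may vanish at x, and the default 0 keeps the whole family regular. *)
pose g j z := if j \in js then (f j z - f j0 z) / (c j z - c j0 z) else 0.
have rg j : regular_at x (g j).
  rewrite /g; case jj: (j \in js); last exact: regular_cst.
  by apply: regularM; [|apply: regularV; last exact: cj0]; exact: regularB.
apply: (@wins_synth_div x M (\sum_(j <- js) m j) (c j0) (f j0) _ _ n l)
  (IH g _ _ _ ujs _ rg sz (leqnn _) _) => //.
- by apply: leq_trans SM; rewrite -add1n leq_add2r.
- move=> h l' rh rl' h0 W j; rewrite inE => /predU1P[->|jj].
    by apply: max_ideal_pow_le h0; apply: leq_trans SM; exact: leq_addr.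
  have rcc : regular_at x (fun z => c j z - c j0 z) by exact: regularB.
  have mM : (m j <= M)%N.
    apply: leq_trans SM; rewrite (big_rem j) //= addnCA; exact: leq_addr.
  have := max_ideal_powD (max_ideal_pow_le mM h0) (max_ideal_powMl rcc (W j jj)).
  apply: max_ideal_pow_ext; apply: filterS (regular_neq0 rcc (cj0 j jj)) => z nz.
  rewrite (synth_divE (c j0) h l' z (c j z)) /g jj.
  rewrite mulrBr [(c j z - c j0 z) * (_ / _)]mulrC divfK //.
  by ring.
- by move=> i j ij jj; apply: inj; rewrite inE ?ij ?jj orbT.
- exact: regular_synth_div.
Qed.

End CoefficientLists.

(** Newton iteration starting from the constant u, with the derivative frozen at its value D at x;
    each step gains one order. *)
Lemma hensel_root (K : closedFieldType) (X : fun_space K) (x : X) (b : X -> K)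
    (u : K) (d N : nat) :
  d%:R != 0 :> K -> u != 0 -> regular_at x b -> u ^+ d = b x ->
  exists c, [/\ regular_at x c, c x = u &
    max_ideal_pow x N (fun z => c z ^+ d - b z)].
Proof.
move=> d0 u0 rb ub; case: d d0 ub => [|d] d0 ub; first by rewrite eqxx in d0.
have rX (f : X -> K) k : regular_at x f -> regular_at x (fun z => f z ^+ k).
  exact: regularX.
(* A positive order is kept throughout, so that the correction e vanishes at x and the new root
   still takes the value u there. *)
suff [c [rc cu cb]] : exists c, [/\ regular_at x c, c x = u &
    max_ideal_pow x N.+1 (fun z => c z ^+ d.+1 - b z)].
  by exists c; split=> //; apply: max_ideal_pow_le cb.
elim: N => [|N [c [rc cu cb]]].
  exists (fun=> u); split=> //; first exact: regular_cst.
  apply: max_ideal_pow1; split; last by rewrite ub subrr.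
  by apply: regularB => //; apply: rX; exact: regular_cst.
pose D := d.+1%:R * u ^+ d.
have D0 : D != 0 by rewrite mulf_neq0 // expf_neq0.
pose e z := (c z ^+ d.+1 - b z) / D.
have me : max_ideal_pow x N.+1 e.
  by apply: max_ideal_powMr => //; exact: regular_cst.
have re := max_ideal_pow_regular me.
(* U is the cofactor in c^(d+1) - (c - e)^(d+1) = e U. The new error is therefore e (D - U), and
   U(x) = D puts the second factor in the maximal ideal. *)
pose U z := \sum_(i < d.+1) c z ^+ (d.+1.-1 - i) * (c z - e z) ^+ i.
have rU : regular_at x U.
  apply: regular_sum => i; apply: regularM; apply: rX => //; exact: regularB.
have e0 : e x = 0 by exact: (max_ideal_pow_eval0 _ me).
have UD : U x = D.
  rewrite /U /D e0 cu (eq_bigr (fun=> u ^+ d)) => [|i _].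
    by rewrite sumr_const card_ord mulr_natl.
  by rewrite subr0 -exprD subnK // -ltnS.
exists (fun z => c z - e z); split; first exact: regularB.
  by rewrite e0 subr0.
have mDU : max_ideal_pow x 1 (fun z => D - U z).
  apply: max_ideal_pow1; split; last by rewrite UD subrr.
  by apply: regularB => //; exact: regular_cst.
rewrite -addn1; apply: eq_max_ideal_pow (max_ideal_powM me mDU) => z.
have -> : (c z - e z) ^+ d.+1 = c z ^+ d.+1 - e z * U z.
  by rewrite /U -[X in X * _](subKr (c z)) -subrXX; ring.
rewrite mulrBr {1}/e mulfVK //; ring.
Qed.

(** * Germs on a subset of the total space of M *)

Section TotalSpaceGerms.
Variables (K : closedFieldType) (X : fun_space K) (M : line_bundle X).
Variable Z : set (total_space M).
Local Notation Y := (sub_fun_space Z).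

Definition sub_proj : regular_map Y X :=
  regular_comp (bundle_proj M) (sub_incl Z).

Definition sub_coord (a : lb_idx M) (w : Y) : K := tot_coord (set_val w) a.

Lemma regular_fibre_poly (y : Y) P : fibre_poly (sub_proj y) P ->
  regular_at y (P \o set_val).
Proof.
move=> fP; apply: (rm_regular (r := sub_incl Z)) => /=.
exists P, (fun=> 1); split=> //.
- by apply: (@fibre_poly_base _ _ M _ (fun=> 1)); exact: regular_cst.
- exact: oner_neq0.
- by apply: near_all => u; rewrite divr1.
Qed.

Lemma regular_sub_coord (y : Y) a : lb_dom M a (sub_proj y) ->
  regular_at y (sub_coord a).
Proof. by move=> /(@fibre_poly_coord _ _ M)/regular_fibre_poly. Qed.

Lemma sub_proj_near (y : Y) (P : X -> Prop) :
  (\forall x \near sub_proj y, P x) -> \forall w \near y, P (sub_proj w).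
Proof. exact: (@rm_continuous _ _ _ sub_proj y). Qed.

Lemma sub_dom_near (y : Y) a : lb_dom M a (sub_proj y) ->
  \forall w \near y, lb_dom M a (sub_proj w).
Proof. by move=> Ua; apply: sub_proj_near; exact: open_near (lb_open M a) Ua _. Qed.

(* The local ring at y is generated, up to m_y^m, by the pulled back germs and
   one fibre coordinate: inverses are truncated geometric series. *)
Lemma regular_mod_ind (y : Y) a m (P : (Y -> K) -> Prop) :
  lb_dom M a (sub_proj y) ->
  (forall F G, P F -> max_ideal_pow y m (fun w => G w - F w) -> P G) ->
  (forall F G, P F -> P G -> P (fun w => F w + G w)) ->
  (forall F G, P F -> P G -> P (fun w => F w * G w)) ->
  (forall f, regular_at (sub_proj y) f -> P (f \o sub_proj)) ->
  P (sub_coord a) ->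
  forall F, regular_at y F -> P F.
Proof.
move=> Ua Pmod PD PM Pbase Pcoord.
have Pext F G : (\forall w \near y, G w = F w) -> P F -> P G.
  move=> FG PF; apply: Pmod PF _.
  apply: max_ideal_pow_ext (max_ideal_pow_cst0 y m).
  by apply: filterS FG => w ->; rewrite subrr.
have Pcst c : P (fun=> c) by apply: (Pbase (fun=> c)); exact: regular_cst.
have Pfibre Q : fibre_poly (sub_proj y) Q -> P (Q \o set_val).
  elim=> {Q} [f rf|i Ui|Q Q' _ IQ _ IQ'|Q Q' _ IQ _ IQ'].
  - exact: Pbase.
  - have /Pbase Ptr := lb_tr_regular Ui Ua.
    apply: Pext (PM _ _ Ptr Pcoord).
    apply: filterS2 (sub_dom_near Ui) (sub_dom_near Ua) => w Wi Wa /=.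
    by rewrite (tot_coord_tr Wi Wa).
  - exact: PD IQ IQ'.
  - exact: PM IQ IQ'.
move=> F [G [Q1 [Q2 [fQ1 fQ2 Q20 GQ]]] FG].
pose q : Y -> K := Q2 \o set_val.
have rq : regular_at y q by exact: regular_fibre_poly.
pose c := q y; have c0 : c != 0 by [].
pose n w := 1 - c^-1 * q w.
have mn : max_ideal y n.
  split; last by rewrite /n mulVf ?subrr.
  by apply: regularB; [|apply: regularM => //]; exact: regular_cst.
have Pn : P n.
  apply: Pext (PD _ _ (Pcst 1) (PM _ _ (Pcst (- c^-1)) (Pfibre _ fQ2))).
  by apply: near_all => w; rewrite /n mulNr.
have PnX k : P (fun w => n w ^+ k).
  elim: k => [|k IH]; first exact: Pcst.
  by apply: Pext (PM _ _ Pn IH); apply: near_all => w; rewrite exprS.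
have Pgeom k : P (fun w => \sum_(i < k) n w ^+ i).
  elim: k => [|k IH].
    by apply: Pext (Pcst 0); apply: near_all => w; rewrite big_ord0.
  by apply: Pext (PD _ _ IH (PnX k)); apply: near_all => w; rewrite big_ord_recr.
have Pinv : P (fun w => (q w)^-1).
  apply: Pmod (PM _ _ (Pcst c^-1) (Pgeom m)) _.
  have := max_ideal_powMr (regularV rq c0) (max_ideal_powX m mn).
  apply: max_ideal_pow_ext; apply: filterS (regular_neq0 rq c0) => w qw.
  have := subrX1 (n w) m; have -> : n w - 1 = - (c^-1 * q w) by rewrite /n; ring.
  move/eqP; rewrite subr_eq => /eqP ->.
  by rewrite mulrDl mul1r mulNr mulNr addrC; congr (_ - _); rewrite mulrAC mulfK.
apply: Pext (PM _ _ (Pfibre _ fQ1) Pinv).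
have GQy : \forall w \near y,
    G (set_val w) = Q1 (set_val w) / Q2 (set_val w).
  exact: (@set_val_near K (total_space M) Z y _ GQ).
have FGy : \forall w \near y, F w = G (set_val w) by [].
by apply: filterS2 FGy GQy => w -> ->.
Qed.

End TotalSpaceGerms.

(** * Concatenation and addition of coefficient lists *)

Section CoefficientListAlgebra.
Variables (K : closedFieldType) (X : fun_space K).
Implicit Types (x z : X) (l : seq (X -> K)).

Lemma horner_fun_cat l l' z (u : K) :
  horner_fun (l ++ l') z u = horner_fun l z u + u ^+ size l * horner_fun l' z u.
Proof.
elim: l => [|h l IH] /=; first by rewrite add0r mul1r.
by rewrite IH exprS; ring.
Qed.

Lemma regular_coefs_cat x l l' :
  regular_coefs x (l ++ l') <-> regular_coefs x l /\ regular_coefs x l'.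
Proof. by elim: l => [|h l IH] /=; [split=> [|[]]|rewrite IH; tauto]. Qed.

Lemma regular_coefs_map x (F : (X -> K) -> X -> K) l :
  (forall h, regular_at x h -> regular_at x (F h)) -> regular_coefs x l ->
  regular_coefs x (map F l).
Proof. by move=> rF; elim: l => //= h l IH [/rF ? /IH]. Qed.

Lemma horner_fun_add x l1 l2 : size l1 = size l2 ->
  regular_coefs x l1 -> regular_coefs x l2 ->
  exists l, [/\ size l = size l1, regular_coefs x l &
    forall z u, horner_fun l z u = horner_fun l1 z u + horner_fun l2 z u].
Proof.
elim: l1 l2 => [|h1 l1 IH] [|h2 l2] //=.
  by move=> _ _ _; exists [::]; split=> // z u; rewrite addr0.
move=> [sz] [rh1 rl1] [rh2 rl2]; have [l [<- rl lE]] := IH _ sz rl1 rl2.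
exists ((fun z => h1 z + h2 z) :: l); split=> //=.
  by split=> //; exact: regularD.
by move=> z u; rewrite lE; ring.
Qed.

End CoefficientListAlgebra.

(** * Germs at a point of the cover as polynomials in tau of degree less than d *)

Section RamifiedPoint.
Variables (K : closedFieldType) (X Y : fun_space K) (p : regular_map Y X).
Variables (y : Y) (tau : Y -> K).

(** The strategy names the entries of [fs] from the last one down. The invariant is that the entries
    not yet played, followed by the replies [l], still represent F modulo m_y^m: a reply in degree q
    alters the value by an element of tau^q m_x^(m-q). *)
Lemma wins_ramified m F fs l : max_ideal y tau ->
  regular_coefs (p y) fs ->
  max_ideal_pow y m (fun w => horner_fun (fs ++ l) (p w) (tau w) - F w) ->
  wins (p y) m (fun l' => max_ideal_pow y m
    (fun w => horner_fun l' (p w) (tau w) - F w)) (size fs) l.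
Proof.
move=> mtau; elim/last_ind: fs l => [|fs f IH] l //.
rewrite size_rcons -cats1 -catA /= => /regular_coefs_cat[rfs [rf _]] fsF.
exists f => // h rh hf; apply: IH => //.
have := max_ideal_powM (max_ideal_powX (size fs) mtau) (max_ideal_pow_comp hf).
have mm : (m <= size fs + (m - size fs))%N by rewrite -leq_subLR.
move=> /(max_ideal_pow_le mm) /(max_ideal_powD fsF).
apply: eq_max_ideal_pow => w /=.
by rewrite !horner_fun_cat /=; ring.
Qed.

Variables (b : X -> K) (d m : nat).
Hypothesis d_gt0 : (0 < d)%N.
Hypothesis reg_b : regular_at (p y) b.
Hypothesis reg_tau : regular_at y tau.
Hypothesis tau_pow : \forall w \near y, tau w ^+ d = b (p w).

(** The length is exactly d, with zeros as padding, so that lists can be added entry by entry and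
    match a game of d moves. *)
Definition mod_coefs (F : Y -> K) : Prop :=
  exists fs, [/\ size fs = d, regular_coefs (p y) fs &
    max_ideal_pow y m (fun w => F w - horner_fun fs (p w) (tau w))].

Lemma mod_coefs_mod F G : mod_coefs F ->
  max_ideal_pow y m (fun w => G w - F w) -> mod_coefs G.
Proof.
move=> [fs [sfs rfs Ffs]] /(max_ideal_powD Ffs) Gfs; exists fs; split=> //.
by apply: eq_max_ideal_pow Gfs => w; ring.
Qed.

Lemma mod_coefsD F G : mod_coefs F -> mod_coefs G ->
  mod_coefs (fun w => F w + G w).
Proof.
move=> [fs [sfs rfs Ffs]] [gs [sgs rgs Ggs]].
have [hs [shs rhs hsE]] := horner_fun_add (etrans sfs (esym sgs)) rfs rgs.
exists hs; split=> //; first by rewrite shs.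
by apply: eq_max_ideal_pow (max_ideal_powD Ffs Ggs) => w; rewrite hsE; ring.
Qed.

Lemma mod_coefs_base f F : regular_at (p y) f -> mod_coefs F ->
  mod_coefs (fun w => f (p w) * F w).
Proof.
move=> rf [fs [sfs rfs Ffs]].
exists [seq (fun z => f z * h z) | h <- fs]; split; first by rewrite size_map.
  by apply: regular_coefs_map rfs => h; exact: regularM.
apply: eq_max_ideal_pow (max_ideal_powMl (rm_regular rf) Ffs) => w /=.
rewrite mulrBr; congr (_ - _).
by elim: fs {sfs rfs Ffs} => [|h fs IH] /=; [rewrite mulr0|rewrite -IH; ring].
Qed.

(** Multiplication by tau shifts the list; the top coefficient g leaves it and returns as the
    constant term b g, since tau^d = b. *)
Lemma mod_coefs_tau F : mod_coefs F -> mod_coefs (fun w => tau w * F w).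
Proof.
move=> [fs [sfs rfs Ffs]]; case/lastP: fs sfs rfs Ffs => [|fs g].
  by move=> d0; move: d_gt0; rewrite -d0.
rewrite size_rcons -cats1 => sfs /regular_coefs_cat[rfs [rg _]] Ffs.
exists ((fun z => b z * g z) :: fs); split=> //=.
  by split=> //; exact: regularM.
apply: max_ideal_pow_ext (max_ideal_powMl reg_tau Ffs).
apply: filterS tau_pow => w; rewrite -sfs horner_fun_cat exprS /= => <-; ring.
Qed.

Lemma mod_coefs1 : mod_coefs (fun=> 1).
Proof.
exists ((fun=> 1) :: nseq d.-1 (fun=> 0)); split.
- by rewrite /= size_nseq prednK.
- split; first exact: regular_cst.
  by elim: (d.-1) => //= k IH; split=> //; exact: regular_cst.
apply: eq_max_ideal_pow (max_ideal_pow_cst0 y m) => w /=.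
have -> : horner_fun (nseq d.-1 (fun=> 0)) (p w) (tau w) = 0.
  by elim: (d.-1) => //= k ->; ring.
by ring.
Qed.

Lemma mod_coefs_regular F : mod_coefs F -> regular_at y F.
Proof.
move=> [fs [_ rfs /max_ideal_pow_regular rF]].
have := regularD rF (horner_fun_regular (@rm_regular _ _ _ p y) reg_tau rfs).
by apply: eq_regular => w; rewrite subrK.
Qed.

Lemma mod_coefsM F G : mod_coefs F -> mod_coefs G ->
  mod_coefs (fun w => F w * G w).
Proof.
move=> [fs [_ rfs Ffs]] cG.
have {Ffs} : max_ideal_pow y m
    (fun w => F w * G w - horner_fun fs (p w) (tau w) * G w).
  apply: eq_max_ideal_pow (max_ideal_powMr (mod_coefs_regular cG) Ffs) => w.
  by rewrite mulrBl.
(* F is now a polynomial in tau, and its Horner scheme only needs multiplications by base germs and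
   by tau. *)
apply: mod_coefs_mod; elim: fs rfs => [_|h fs IH /= [rh /IH cfs]].
  apply: mod_coefs_mod (mod_coefs_base (regular_cst _ 0) mod_coefs1) _.
  apply: eq_max_ideal_pow (max_ideal_pow_cst0 y m) => w /=; ring.
apply: mod_coefs_mod (mod_coefsD (mod_coefs_base rh cG) (mod_coefs_tau cfs)) _.
by apply: eq_max_ideal_pow (max_ideal_pow_cst0 y m) => w /=; ring.
Qed.

End RamifiedPoint.

(** * Winning the game at a point of X, on and off the branch locus *)

Section CyclicCoverJets.
Variables (K : closedFieldType) (X : fun_space K) (M : line_bundle X) (d : nat).
Variable s : lb_family (lb_pow M d%:Z).
Hypothesis s_section : global_section s.
Hypothesis d_neq0 : d%:R != 0 :> K.
Local Notation Y := (cyclic_cover s).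
Local Notation p := (cyclic_proj s).
Local Notation tau a := (@sub_coord K X M (zero_locus (cyclic_equation s)) a).

Let d_gt0 : (0 < d)%N.
Proof. by rewrite lt0n; apply: contra_neq d_neq0 => ->. Qed.

Lemma cyclic_coord_pow (w : Y) a : lb_dom M a (p w) -> tau a w ^+ d = s a (p w).
Proof.
move=> Ua; have Zw : zero_locus (cyclic_equation s) (set_val w).
  exact: set_valP.
by have /eqP := Zw a Ua; rewrite subr_eq0 => /eqP.
Qed.

(** One coordinate determines those in all charts around the base point through the transition
    functions; the remaining ones are 0 by convention. *)
Lemma cyclic_pt_inj (w w' : Y) a : lb_dom M a (p w) ->
  p w = p w' -> tau a w = tau a w' -> w = w'.
Proof.
rewrite /sub_coord /= => Ua pp tt; apply: val_inj; move: Ua pp tt.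
rewrite /set_val /=; case: (val w) => x u utr uout.
case: (val w') => x' u' utr' uout' /=.
move=> Ua xx ua; subst x'; have uu : u = u'.
  apply/funext => i; case: (pselect (lb_dom M i x)) => Ui.
    by rewrite (utr _ _ Ui Ua) ua -utr'.
  by rewrite uout // uout'.
by subst u'; congr TotalPt; exact: Prop_irrelevance.
Qed.

Variables (r : nat) (y : 'I_r -> Y) (m : 'I_r -> nat).
Hypothesis y_inj : injective y.
Hypothesis m_gt0 : forall j, (0 < m j)%N.
Variables (x : X) (a : lb_idx M).
Hypothesis Ua : lb_dom M a x.
Variable t : 'I_r -> Y -> K.
Hypothesis reg_t : forall j, p (y j) = x -> regular_at (y j) (t j).

Let Uay j : p (y j) = x -> lb_dom M a (p (y j)). Proof. by move=> ->. Qed.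

Let reg_s : regular_at x (s a). Proof. by case: (s_section x) => + _; apply. Qed.

Let coord_pow_near j : p (y j) = x ->
  \forall w \near y j, tau a w ^+ d = s a (p w).
Proof.
by move=> yx; apply: filterS (sub_dom_near (Uay yx)) => w; exact: cyclic_coord_pow.
Qed.

Let interpolates l := forall j, p (y j) = x ->
  max_ideal_pow (y j) (m j) (fun w => horner_fun l (p w) (tau a w) - t j w).

Lemma wins_over_branch_point : s a x = 0 ->
  wins x (\sum_(j | `[< p (y j) = x >]) m j) interpolates d [::].
Proof.
move=> s0; case: (pselect (exists j, p (y j) = x)) => [[j yx]|noj]; last first.
  by apply: wins_trivial => l j yx; case: noj; exists j.
have tau0 i : p (y i) = x -> tau a (y i) = 0.
  move=> yix; apply/eqP; have := cyclic_coord_pow (Uay yix).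
  by rewrite yix s0 => /eqP; rewrite expf_eq0 => /andP[].
have onlyj i : p (y i) = x -> i = j.
  move=> yix; apply: y_inj; apply: (@cyclic_pt_inj _ _ a) (Uay yix) _ _.
    by rewrite yix.
  by rewrite !tau0.
rewrite (big_pred1 j); last first.
  by move=> i; apply/asboolP/eqP => [/onlyj|->].
have reg_tau := regular_sub_coord (Uay yx).
have rs : regular_at (p (y j)) (s a) by rewrite yx.
have taupow := coord_pow_near yx.
(* The germs that are polynomials in tau modulo m_y^m contain tau and the base germs and are closed
   under sums and products, hence they are all germs. *)
have [fs [sfs rfs fsF]] : mod_coefs p (y j) (tau a) d (m j) (t j).
  have c1 := mod_coefs1 p (y j) (tau a) (m j) d_gt0.
  apply: (regular_mod_ind (m := m j) (Uay yx)) (reg_t yx).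
  - exact: mod_coefs_mod.
  - exact: mod_coefsD.
  - exact: (mod_coefsM d_gt0 rs reg_tau taupow).
  - move=> f rf; apply: mod_coefs_mod (mod_coefs_base rf c1) _.
    apply: eq_max_ideal_pow (max_ideal_pow_cst0 (y j) (m j)) => w /=.
    by rewrite mulr1 subrr.
  - apply: mod_coefs_mod (mod_coefs_tau d_gt0 rs reg_tau taupow c1) _.
    apply: eq_max_ideal_pow (max_ideal_pow_cst0 (y j) (m j)) => w /=.
    by rewrite mulr1 subrr.
apply: wins_sub (_ : wins x (m j) (fun l => max_ideal_pow (y j) (m j)
  (fun w => horner_fun l (p w) (tau a w) - t j w)) d [::]) => //.
  by move=> l _ jl i /onlyj ->.
have mtau : max_ideal (y j) (tau a) by split=> //; exact: tau0.
have := @wins_ramified K X Y p (y j) (tau a) (m j) (t j) fs [::] mtau rfs.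
rewrite sfs yx; apply; rewrite cats0.
apply: eq_max_ideal_pow (max_ideal_powMl (regular_cst _ (-1)) fsF) => w.
by ring.
Qed.

(** Off the branch locus the projection is unramified: modulo m_y^m, tau is the pull-back of a d-th
    root c of s on X, and so every germ at y is a pull-back. *)
Let approx j : s a x != 0 -> p (y j) = x -> exists c f,
  [/\ regular_at x c, c x = tau a (y j), regular_at x f,
      max_ideal_pow (y j) (m j) (fun w => tau a w - c (p w)) &
      max_ideal_pow (y j) (m j) (fun w => t j w - f (p w))].
Proof.
move=> s0 yx; have reg_tau := regular_sub_coord (Uay yx).
pose u := tau a (y j).
have ud : u ^+ d = s a x by rewrite /u cyclic_coord_pow ?yx.
have u0 : u != 0.
  by apply: contra_neq s0 => u0; rewrite -ud u0 expr0n gtn_eqF.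
have [c [rc cu cs]] := hensel_root (m j) d_neq0 u0 reg_s ud.
have rcp : regular_at (y j) (c \o p) by apply: rm_regular; rewrite yx.
have tauc : max_ideal_pow (y j) (m j) (fun w => tau a w - c (p w)).
  (* V is the cofactor in tau^d - c^d = (tau - c) V. Its value d u^(d-1) at y is nonzero, so tau - c
     = (s - c^d) / V inherits the order of s - c^d. *)
  pose V w := \sum_(i < d) tau a w ^+ (d.-1 - i) * c (p w) ^+ i.
  have rV : regular_at (y j) V.
    by apply: regular_sum => i; apply: regularM; exact: regularX.
  have V0 : V (y j) != 0.
    rewrite /V yx cu (eq_bigr (fun=> u ^+ d.-1)) => [|i _].
      by rewrite sumr_const card_ord -mulr_natl mulf_neq0 // expf_neq0.
    by rewrite -exprD subnK // -ltnS prednK.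
  have csp : max_ideal_pow (y j) (m j) (fun w => s a (p w) - c (p w) ^+ d).
    have : max_ideal_pow (p (y j)) (m j) (fun z => s a z - c z ^+ d).
      rewrite yx; apply: eq_max_ideal_pow (max_ideal_powMl (regular_cst _ (-1)) cs).
      by move=> z; ring.
    exact: max_ideal_pow_comp.
  apply: max_ideal_pow_ext (max_ideal_powMr (regularV rV V0) csp).
  apply: filterS2 (coord_pow_near yx) (regular_neq0 rV V0) => w <- Vw.
  by rewrite subrXX -/(V w) mulfK.
exists c.
pose P F := exists2 f, regular_at x f &
  max_ideal_pow (y j) (m j) (fun w => F w - f (p w)).
suff [f rf tf] : P (t j) by exists f.
have Preg F : P F -> regular_at (y j) F.
  move=> [f rf /max_ideal_pow_regular rF].
  have rfp : regular_at (y j) (f \o p) by apply: rm_regular; rewrite yx.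
  by apply: eq_regular (regularD rF rfp) => w /=; rewrite subrK.
apply: (regular_mod_ind (m := m j) (Uay yx)) (reg_t yx).
- move=> F G [f rf Ff] GF; exists f => //.
  by apply: eq_max_ideal_pow (max_ideal_powD Ff GF) => w; ring.
- move=> F G [f rf Ff] [g rg Gg]; exists (fun z => f z + g z).
    exact: regularD.
  by apply: eq_max_ideal_pow (max_ideal_powD Ff Gg) => w; ring.
- move=> F G PF PG; have rF := Preg _ PF; case: PF PG => f rf Ff [g rg Gg].
  exists (fun z => f z * g z); first exact: regularM.
  have rgp : regular_at (y j) (g \o p) by apply: rm_regular; rewrite yx.
  have := max_ideal_powD (max_ideal_powMr rgp Ff) (max_ideal_powMl rF Gg).
  by apply: eq_max_ideal_pow => w /=; ring.
- move=> f; rewrite [_ (y j)]yx => rf; exists f => //.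
  by apply: eq_max_ideal_pow (max_ideal_pow_cst0 (y j) (m j)) => w; rewrite /= subrr.
- by exists c.
Qed.

Lemma wins_off_branch : s a x != 0 ->
  wins x (\sum_(j | `[< p (y j) = x >]) m j) interpolates d [::].
Proof.
move=> s0; pose js := [seq j <- enum 'I_r | `[< p (y j) = x >]].
have jsP j : (j \in js) = `[< p (y j) = x >] by rewrite mem_filter mem_enum andbT.
have ujs : uniq js by rewrite filter_uniq ?enum_uniq.
(* Indices of points not over x get the default 0, so that the nodes and the values form total
   families of regular germs. *)
have /choice[cf cfP] : forall j, exists cf : (X -> K) * (X -> K),
    regular_at x cf.1 /\ regular_at x cf.2 /\ (p (y j) = x ->
    [/\ cf.1 x = tau a (y j),
      max_ideal_pow (y j) (m j) (fun w => tau a w - cf.1 (p w)) &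
      max_ideal_pow (y j) (m j) (fun w => t j w - cf.2 (p w))]).
  move=> j; case: (pselect (p (y j) = x)) => yx; last first.
    by exists (fun=> 0, fun=> 0); split; [|split=> //]; exact: regular_cst.
  by have [c [f [rc cu rf tc tf]]] := approx s0 yx; exists (c, f).
pose c j := (cf j).1; pose f j := (cf j).2.
have rc j : regular_at x (c j) by case: (cfP j).
have rf j : regular_at x (f j) by case: (cfP j) => _ [].
have tau_inj : {in js &, injective (fun j => tau a (y j))}.
  move=> i j; rewrite !jsP => /asboolP ix /asboolP jx tt; apply: y_inj.
  by apply: (cyclic_pt_inj (Uay ix)) tt; rewrite ix.
(* The coordinates of the points over x are distinct roots of T^d - s(x), so d moves suffice. *)
have szjs : (size js <= d)%N.
  have := @max_poly_roots _ ('X^d - (s a x)%:P) [seq tau a (y j) | j <- js].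
  rewrite size_map size_XnsubC // ltnS; apply.
  - by rewrite -size_poly_eq0 size_XnsubC.
  - apply/allP => _ /mapP[j + ->]; rewrite jsP => /asboolP yx.
    by rewrite rootE !hornerE cyclic_coord_pow ?yx ?subrr.
  - by rewrite map_inj_in_uniq.
have -> : (\sum_(j | `[< p (y j) = x >]) m j = \sum_(j <- js) m j)%N.
  by rewrite big_filter [RHS]big_enum_cond.
have cinj : {in js &, forall i j, c i x = c j x -> i = j}.
  move=> i j ij jj; have [_ [_]] := cfP i; have [_ [_]] := cfP j.
  move: (ij) (jj); rewrite !jsP => /asboolP ix /asboolP jx.
  move=> /(_ jx)[cj _ _] /(_ ix)[ci _ _].
  by rewrite /c ci cj => /tau_inj; exact.
have W := @wins_interpolation K X x _ js c f m _ d [::]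
  ujs cinj rc rf m_gt0 szjs (leqnn _) I.
apply: wins_sub W => // l rl Wl j yx.
have [_ [_ /(_ yx)[cu tc tf]]] := cfP j.
have /Wl lf : j \in js by rewrite jsP; exact/asboolP.
have {}lf : max_ideal_pow (y j) (m j)
    (fun w => horner_fun l (p w) (c j (p w)) - f j (p w)).
  by apply: (@max_ideal_pow_comp _ _ _ p (y j) _
    (fun z => horner_fun l z (c j z) - f j z)); rewrite yx.
have rtau := regular_sub_coord (Uay yx).
have rcp : regular_at (y j) (fun w => c j (p w)).
  by apply: (@rm_regular _ _ _ p); rewrite yx.
(* Replacing the node c by tau in the Horner scheme costs only an element of m_y^m, as tau is
   congruent to c. *)
have ltc : max_ideal_pow (y j) (m j)
    (fun w => horner_fun l (p w) (tau a w) - horner_fun l (p w) (c j (p w))).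
  elim: l rl {Wl lf} => [_|h l IH /= [rh rl]].
    by apply: eq_max_ideal_pow (max_ideal_pow_cst0 (y j) (m j)) => w; rewrite subrr.
  have rl' : regular_at (y j) (fun w => horner_fun l (p w) (c j (p w))).
    apply: horner_fun_regular rcp _; first exact: (@rm_regular _ _ _ p (y j)).
    by rewrite yx.
  have := max_ideal_powD (max_ideal_powMl rtau (IH rl)) (max_ideal_powMr rl' tc).
  by apply: eq_max_ideal_pow => w; rewrite /c; ring.
have := max_ideal_powB (max_ideal_powD ltc lf) tf.
by apply: eq_max_ideal_pow => w; rewrite /f; ring.
Qed.

Lemma wins_cyclic_cover :
  wins x (\sum_(j | `[< p (y j) = x >]) m j) interpolates d [::].
Proof.
by case: (eqVneq (s a x) 0); [exact: wins_over_branch_point|exact: wins_off_branch].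
Qed.

End CyclicCoverJets.

(** * Global sections and the flexible form of jet ampleness *)

Lemma lb_chart_dom (K : closedFieldType) (X : fun_space K) (L : line_bundle X)
    x : lb_dom L (lb_chart L x) x.
Proof. exact: projT2 (cid (lb_cover L x)). Qed.

Lemma lb_dom_near (K : closedFieldType) (X : fun_space K) (L : line_bundle X)
    i x : lb_dom L i x -> \forall z \near x, lb_dom L i z.
Proof. by move=> Ui; apply: open_near (lb_open L i) Ui _. Qed.

(** The chart used at z varies with z; by [iso_compat] it may be replaced near x by the fixed chart
    of x, where regularity is visible. *)
Lemma iso_section_global (K : closedFieldType) (X : fun_space K)
    (L M : line_bundle X) (phi : lb_iso L M) (s : lb_family L) :
  global_section s -> global_section (iso_section phi s).
Proof.
move=> gs x; split=> [a Ua|a b Ua Ub].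
  have Ui := lb_chart_dom L x; set i := lb_chart L x in Ui.
  have [/(_ i Ui) rs _] := gs x.
  apply: regular_ext (regularM (iso_regular phi Ua Ui) rs).
  apply: filterS2 (lb_dom_near Ua) (lb_dom_near Ui) => z Wa Wi.
  have Wc := lb_chart_dom L z.
  rewrite /iso_section (iso_compat phi Wa Wa Wi Wc) lb_tr_id // mul1r -mulrA.
  by have [_ /(_ _ _ Wc Wi) <-] := gs z.
have Uc := lb_chart_dom L x.
by rewrite /iso_section (iso_compat phi Ua Ub Uc Uc) lb_tr_id // mulr1 mulrA.
Qed.

Lemma zero_section (K : closedFieldType) (X : fun_space K) (L : line_bundle X) :
  global_section ((fun _ _ => 0) : lb_family L).
Proof. by move=> x; split=> [i _|*]; [exact: regular_cst|rewrite mulr0]. Qed.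

(** Brings arbitrary orders of total at most k + 1 into the form required by [jet_ample]: points of
    order 0 are discarded and the deficit is added to the order at one remaining point. *)
Lemma jet_ample_le (K : closedFieldType) (X : fun_space K) (L : line_bundle X)
    (k : nat) (xs : seq X) (mu : X -> nat) (t : X -> lb_family L) :
  jet_ample L k -> uniq xs -> (\sum_(x <- xs) mu x <= k.+1)%N ->
  (forall x, x \in xs -> section_germ x (t x)) ->
  exists2 s : lb_family L, global_section s &
    forall x, x \in xs -> eq_jet x (mu x) s (t x).
Proof.
move=> Lk uxs mule germ.
have jet0 (s : lb_family L) x : global_section s -> x \in xs -> mu x = 0%N ->
    eq_jet x (mu x) s (t x).
  move=> gs xxs -> i Ui; apply: max_ideal_pow0; apply: regularB.
    by have [+ _] := gs x; exact.
  by have [+ _] := nbhs_singleton (germ x xxs); exact.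
pose ys := [seq x <- xs | 0 < mu x]%N.
have uys : uniq ys by rewrite filter_uniq.
have yxs x : x \in ys -> x \in xs by rewrite mem_filter => /andP[].
have sumys : (\sum_(x <- ys) mu x = \sum_(x <- xs) mu x)%N.
  rewrite big_filter [RHS](bigID (fun x => 0 < mu x)%N) /=.
  rewrite [X in (_ + X)%N]big1 ?addn0 //.
  by move=> x; rewrite -eqn0Ngt => /eqP.
(* With no point of positive order left, there is nowhere to put the deficit, and the zero section
   serves. *)
case ysE: ys => [|x0 ys'].
  exists (fun _ _ => 0); first exact: zero_section.
  move=> x xxs; apply: jet0 => //; first exact: zero_section.
  have : x \notin ys by rewrite ysE.
  by rewrite mem_filter xxs andbT -eqn0Ngt => /eqP.
have x0ys : x0 \in ys by rewrite ysE mem_head.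
pose nu x := (mu x + (if x == x0 then k.+1 - (\sum_(x <- xs) mu x)%N else 0))%N.
have sumnu : (\sum_(x <- ys) nu x = k.+1)%N.
  rewrite big_split /= sumys; move: (\sum_(x <- xs) mu x)%N mule => S Sk.
  rewrite (bigD1_seq x0) //= eqxx big1 ?addn0 ?subnKC //.
  by move=> x /negbTE ->.
pose y (i : 'I_(size ys)) := tnth (in_tuple ys) i.
have yys i : y i \in ys by exact: mem_tnth.
have [//|i|||s gs sj] := Lk _ y (fun i => nu (y i)) _ _ _ (fun i => t (y i)).
- move=> i j /eqP; rewrite /y !(tnth_nth x0) nth_uniq //= => /eqP; exact: val_inj.
- by have := yys i; rewrite mem_filter /nu => /andP[mu0 _]; rewrite addn_gt0 mu0.
- by rewrite -sumnu [RHS]big_tnth.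
- by move=> i; apply: germ; exact: yxs.
exists s => // x xxs; case: (posnP (mu x)) => [|mu0]; first exact: jet0.
have xys : x \in ys by rewrite mem_filter mu0.
have [i xi] : exists i, x = y i by apply/(tnthP (in_tuple ys)).
move=> a Ua; rewrite xi in Ua *; apply: max_ideal_pow_le (sj i a Ua).
exact: leq_addr.
Qed.

(** * Lists of sections of the twists L - qM *)

Section TwistedSections.
Variables (K : closedFieldType) (X : fun_space K) (L M : line_bundle X).
Local Notation twist q := (lb_tensor L (lb_pow M (- q%:Z))).
Local Notation family := (lb_idx L * lb_idx M -> X -> K)%type.

Lemma section_germ_of (N : line_bundle X) i x f : lb_dom N i x ->
  regular_at x f ->
  section_germ x ((fun j z => lb_tr N j i z * f z) : lb_family N).
Proof.
move=> Ui rf; apply: filterS2 (lb_dom_near Ui) (regular_near rf) => z Wi rz.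
split=> [j Wj|j l Wj Wl]; last by rewrite mulrA lb_tr_cocycle.
by apply: regularM => //; exact: lb_tr_regular.
Qed.

(** Sections of different twists fit in one list because the charts of L - qM do not depend on q. *)
Fixpoint twisted_sections (n : nat) (l : seq family) : Prop :=
  if l is s :: l' then
    @global_section K X (twist n) s /\ twisted_sections n.+1 l'
  else True.

Definition local_coefs (i : lb_idx L) (a : lb_idx M) (l : seq family) :=
  [seq s (i, a) | s <- l].

Lemma regular_local_coefs n l i a x : lb_dom L i x -> lb_dom M a x ->
  twisted_sections n l -> regular_coefs x (local_coefs i a l).
Proof.
move=> Ui Ua; elim: l n => //= s l IH n [gs /IH rl]; split=> //.
by have [+ _] := gs x; exact.
Qed.

(** Under a change of charts the factor g^(-q) of s_q, with g the transition function of M, cancels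
    against the factor g^q of tau^q; only the initial shift n is left. *)
Lemma horner_local_coefs n l i j a b z (u v : K) :
  lb_dom L i z -> lb_dom L j z -> lb_dom M a z -> lb_dom M b z ->
  u = lb_tr M a b z * v -> twisted_sections n l ->
  horner_fun (local_coefs i a l) z u =
  lb_tr L i j z * lb_tr M a b z ^ (- n%:Z) * horner_fun (local_coefs j b l) z v.
Proof.
move=> Ui Uj Ua Ub ->; elim: l n => [|s l IH] n /=; first by rewrite mulr0.
move=> [gs /IH ->]; have [_ sz] := gs z.
rewrite (sz (i, a) (j, b)) //= [in RHS]mulrDr; congr (_ + _).
have -> : lb_tr M a b z ^ (- n%:Z) = lb_tr M a b z ^ (- n.+1%:Z) * lb_tr M a b z.
  rewrite -[X in _ * X]expr1z -expfzDr ?(lb_tr_neq0 Ua Ub) //.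
  by congr (_ ^ _); rewrite -addn1 PoszD opprD subrK.
by rewrite /local_coefs; ring.
Qed.

(** The games at all points of [xs] are played simultaneously: in degree q one global section of L -
    qM with the jets named by the strategies is the reply at every point. *)
Lemma exists_twisted_sections (xs : seq X) (w : X -> nat)
    (G : X -> seq (X -> K) -> Prop) (d : nat) :
  (forall q, (q < d)%N -> forall t : X -> lb_family (twist q),
    (forall x, x \in xs -> section_germ x (t x)) ->
    exists2 s : lb_family (twist q), global_section s &
      forall x, x \in xs -> eq_jet x (w x - q) s (t x)) ->
  (forall x, x \in xs -> wins x (w x) (G x) d [::]) ->
  exists2 l, twisted_sections 0 l &
    forall x, x \in xs -> G x (local_coefs (lb_chart L x) (lb_chart M x) l).
Proof.
move=> jets W0.
suff H n l : (n <= d)%N -> twisted_sections n l ->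
  (forall x, x \in xs -> wins x (w x) (G x) n
     (local_coefs (lb_chart L x) (lb_chart M x) l)) ->
  exists2 l, twisted_sections 0 l & forall x, x \in xs ->
    G x (local_coefs (lb_chart L x) (lb_chart M x) l) by exact: (H d [::]).
elim: n l => [|n IH] l nd sl Wl; first by exists l.
have /choice[f fP] : forall x, exists f : X -> K, x \in xs ->
    regular_at x f /\ forall h, regular_at x h ->
      max_ideal_pow x (w x - n) (fun z => h z - f z) ->
      wins x (w x) (G x) n
        (h :: local_coefs (lb_chart L x) (lb_chart M x) l).
  move=> x; case: (boolP (x \in xs)) => [/Wl[f rf Wf]|]; first by exists f.
  by move=> _; exists (fun=> 0).
have Uc x : lb_dom (twist n) (lb_chart L x, lb_chart M x) x.
  by split; exact: lb_chart_dom.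
have [|s gs sj] := jets n nd (fun x i z =>
    lb_tr (twist n) i (lb_chart L x, lb_chart M x) z * f x z).
  by move=> x /fP[rf _]; apply: section_germ_of (Uc x) rf.
apply: (IH (s :: l)) => //; first exact: ltnW.
move=> x xxs; have [rf Wf] := fP x xxs; apply: Wf.
  by have [+ _] := gs x; apply; exact: Uc.
apply: max_ideal_pow_ext (sj x xxs _ (Uc x)).
by apply: filterS (lb_dom_near (Uc x)) => z Wz; rewrite lb_tr_id ?mul1r.
Qed.

End TwistedSections.

(** * From lists of twisted sections to sections of the pull-back of L *)

Section CoverSections.
Variables (K : closedFieldType) (X : fun_space K) (M L : line_bundle X).
Variable Z : set (total_space M).
Local Notation Y := (sub_fun_space Z).
Local Notation p := (sub_proj Z).

(* The section sum_q tau^q p^*(s_q) of p^*L. *)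
Definition cover_section (l : seq (lb_idx L * lb_idx M -> X -> K)) :
    lb_family (lb_pullback p L) :=
  fun (i : lb_idx L) w => horner_fun (local_coefs i (lb_chart M (p w)) l) (p w)
    (@sub_coord K X M Z (lb_chart M (p w)) w).

Lemma cover_sectionE l i j a (w : Y) : twisted_sections 0 l ->
  lb_dom L i (p w) -> lb_dom L j (p w) -> lb_dom M a (p w) ->
  cover_section l i w = lb_tr L i j (p w) *
    horner_fun (local_coefs j a l) (p w) (sub_coord a w).
Proof.
move=> sl Ui Uj Ua; have Uc := lb_chart_dom M (p w).
rewrite /cover_section (horner_local_coefs Ui Uj Uc Ua (tot_coord_tr Uc Ua) sl).
by rewrite oppr0 expr0z mulr1.
Qed.

Lemma cover_section_global l : twisted_sections 0 l ->
  global_section (cover_section l).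
Proof.
move=> sl y; split=> [i Ui|i j Ui Uj]; last first.
  have Uc := lb_chart_dom M (p y).
  rewrite (cover_sectionE sl Ui Uj Uc) (cover_sectionE sl Uj Uj Uc).
  by rewrite lb_tr_id // mul1r.
have Uc := lb_chart_dom M (p y); set a := lb_chart M _ in Uc.
apply: (@regular_ext _ _ _ (fun w =>
  horner_fun (@local_coefs K X L M i a l) (p w) (sub_coord a w))); last first.
  apply: horner_fun_regular (regular_sub_coord Uc) _.
    exact: (@rm_regular _ _ _ p y).
  exact: (@regular_local_coefs K X L M 0 l i a (p y) Ui Uc sl).
have Ni := lb_dom_near Ui.
apply: filterS2 (sub_dom_near Uc) Ni => w Wa Wi.
by rewrite (cover_sectionE sl Wi Wi Wa) lb_tr_id // mul1r.
Qed.

(** One pair of charts suffices, since the other charts of L multiply the difference by a regular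
    germ. *)
Lemma cover_section_jet l (y : Y) k (t : lb_family (lb_pullback p L)) j a :
  twisted_sections 0 l -> section_germ y t ->
  lb_dom L j (p y) -> lb_dom M a (p y) ->
  max_ideal_pow y k (fun w =>
    horner_fun (local_coefs j a l) (p w) (sub_coord a w) - t j w) ->
  eq_jet y k (cover_section l) t.
Proof.
move=> sl gt Uj Ua jet i Ui.
have rtr : regular_at y (lb_tr L i j \o p).
  by apply: rm_regular; exact: lb_tr_regular.
apply: max_ideal_pow_ext (max_ideal_powMl rtr jet).
have Ni := lb_dom_near Ui; have Nj := sub_proj_near (lb_dom_near Uj).
apply: filterS3 (filterI Ni Nj) (sub_dom_near Ua) gt => w [Wi Wj] Wa [_ tw].
by rewrite (cover_sectionE sl Wi Wj Wa) (tw i j Wi Wj) mulrBr.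
Qed.

End CoverSections.

(** * Counting multiplicities and assembling the section *)

Lemma leq_sum_sub (I : eqType) (r : seq I) (F : I -> nat) q :
  (\sum_(i <- r) (F i - q) <= \sum_(i <- r) F i - q)%N.
Proof.
elim: r => [|i r IH]; first by rewrite !big_nil.
rewrite !big_cons; set S := (\sum_(j <- r) F j)%N in IH *.
apply: leq_trans (leq_add (leqnn _) IH) _; case: (leqP q S) => qS.
  by rewrite -addnBA // leq_add2r leq_subr.
by rewrite (eqP (ltnW qS : S - q == 0)%N) addn0 leq_sub2r // leq_addr.
Qed.

Theorem cyclic_cover_jet_ample (K : closedFieldType) (X : fun_space K)
    (M L : line_bundle X) (d k : nat) (s : lb_family (lb_pow M d%:Z)) :
  global_section s -> d%:R != 0 :> K ->
  (forall q : nat, (q <= minn k d.-1)%N ->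
     jet_ample (lb_tensor L (lb_pow M (- q%:Z))) (k - q)) ->
  jet_ample (lb_pullback (cyclic_proj s) L) k.
Proof.
move=> gs d0 ample r y m yinj m0 msum t gt.
pose p := cyclic_proj s.
pose w x := (\sum_(j | `[< p (y j) = x >]) m j)%N.
pose xs := undup [seq p (y j) | j <- enum 'I_r].
have yxs j : p (y j) \in xs.
  by rewrite mem_undup; 
    apply/mapP; exists j; rewrite ?mem_enum.
(* Each prescribed point is counted exactly once, over its image. *)
have wsum : (\sum_(x <- xs) w x = k.+1)%N.
  rewrite -msum /w (eq_bigr _ (fun x _ => big_mkcond _ _)) exchange_big /=.
  apply: eq_bigr => j _; rewrite (bigD1_seq _ (yxs j) (undup_uniq _)).
  case: asboolP => [_|/(_ erefl)[]].
  rewrite big1 => [|x xj]; first exact: addn0.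
  by rewrite asboolF // => xE; case/eqP: xj; rewrite -xE.
have [q qd t' gt'||l sl Gl] := @exists_twisted_sections K X L M xs w (fun x l =>
  forall j, p (y j) = x -> max_ideal_pow (y j) (m j) (fun v =>
    horner_fun l (p v) (sub_coord (lb_chart M x) v) - t j (lb_chart L x) v)) d.
(* The orders needed at step q add up to at most k + 1 - q, which is what (k-q)-jet ampleness
   provides. *)
- have wq := leq_sum_sub xs w q; rewrite wsum in wq.
  case: (leqP q k) => qk.
    apply: (@jet_ample_le _ _ _ (k - q)) gt';
      [|exact: undup_uniq|by rewrite -subSn].
    by apply: ample; rewrite leq_min qk -ltnS prednK // (leq_trans _ qd).
  (* For q > k that bound is 0, so no jet is prescribed and s_q = 0 will do. *)
  exists (fun _ _ => 0); first exact: zero_section.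
  move: wq; rewrite (eqP (qk : k.+1 - q == 0)%N) leqn0 sum_nat_seq_eq0 => /allP wq.
  move=> x xxs; have /eqP -> := wq x xxs; move=> i Ui; apply: max_ideal_pow0.
  apply: regularB; first exact: regular_cst.
  by have [+ _] := nbhs_singleton (gt' x xxs); exact.
- move=> x _; apply: wins_cyclic_cover => // [|j yx]; first exact: lb_chart_dom.
  have [+ _] := nbhs_singleton (gt j); apply.
  by rewrite /= -[X in _ X]/(p (y j)) yx; exact: lb_chart_dom.
exists (cover_section l); first exact: cover_section_global.
move=> j; apply: cover_section_jet sl (gt j) _ _ (Gl _ (yxs j) j erefl);
  exact: lb_chart_dom.
Qed.

Theorem theorem2p1 (R : realType) (X : fun_space R[i]) (B : set X) (d : nat)
    (M OB L : line_bundle X) (sB : lb_family OB)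
    (phi : lb_iso OB (lb_pow M d%:Z)) (k : nat) :
  smooth_projective_variety X ->
  smooth_divisor B ->
  (0 < d)%N ->
  global_section sB ->
  zero_divisor_is sB B ->
  (forall q : nat, (q <= minn k d.-1)%N ->
     jet_ample (lb_tensor L (lb_pow M (- q%:Z))) (k - q)) ->
  jet_ample (lb_pullback (cyclic_proj (iso_section phi sB)) L) k.
Proof.
move=> _ _ d0 gsB _; apply: cyclic_cover_jet_ample.
  exact: iso_section_global.
by rewrite Num.Theory.pnatr_eq0 -lt0n.
Qed.
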